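(* Let $\mathcal A$ be a unital $C^*$-algebra and let $\mathcal B$ be a von Neumann algebra acting on a Hilbert space $\mathcal H$. Let $E$ be a Hilbert $\mathcal A$-module, let $E'$ be a von Neumann $\mathcal B$-module, and let $\tau:\mathcal A\to\mathcal B$ be a completely positive map. If $T:E\to E'$ is a $\tau$-map, then there exist: (i) (a) a von Neumann $\mathcal B$-module $F$ and a representation $\pi:\mathcal A\to \mathcal B^a(F)$, (b) a map $V\in \mathcal B^a(\mathcal B,F)$ such that $\tau(a)b=V^{*}\pi(a)Vb$ for all $a\in\mathcal A$ and $b\in\mathcal B$; (ii) (a) a von Neumann $\mathcal B$-module $F'$ and a quasi-representation $\Psi:E\to \mathcal B^a(F,F')$ such that $\pi$ is associated to $\Psi$, (b) a coisometry $S$ from $E'$ onto $F'$ satisfying $T(x)b=S^{*}\Psi(x)Vb$ for all $x\in E$ and $b\in\mathcal B$.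
   Context: Inner products on (pre-)Hilbert $C^*$-modules are conjugate linear in the first variable and linear in the second, with $\langle x,yb\rangle=\langle x,y\rangle b$. A von Neumann algebra acting on $\mathcal H$ is a strongly closed $C^*$-subalgebra of $\mathcal B(\mathcal H)$ containing the identity operator. A linear map $\tau:\mathcal A\to\mathcal B$ is completely positive if $\sum_{i,j=1}^n b_j^*\tau(a_j^*a_i)b_i\ge 0$ for all $n\in\mathbb N$, $a_1,\dots,a_n\in\mathcal A$, $b_1,\dots,b_n\in\mathcal B$. For (pre-)Hilbert $\mathcal B$-modules $E_1,E_2$, $\mathcal B^a(E_1,E_2)$ denotes the set of adjointable maps $E_1\to E_2$ (maps $S$ for which there is $S^*:E_2\to E_1$ with $\langle Sx,y\rangle=\langle x,S^*y\rangle$), $\mathcal B^a(E_1):=\mathcal B^a(E_1,E_1)$, and $\mathcal B^r(E_1,E_2)$ denotes the set of bounded right $\mathcal B$-linear maps. The algebra $\mathcal B$ is a Hilbert $\mathcal B$-module with $\langle b,c\rangle=b^*c$. Von Neumann module: for a (pre-)Hilbert $\mathcal B$-module $E$, let $E\odot\mathcal H$ be the interior tensor product (a Hilbert space). Each $x\in E$ is identified with the bounded operator $L_x:\mathcal H\to E\odot\mathcal H$, $L_x(h)=x\odot h$ (so $L_{x_1}^*L_{x_2}=\langle x_1,x_2\rangle$). $E$ is a von Neumann $\mathcal B$-module if, under this identification, $E$ is strongly closed in $\mathcal B(\mathcal H,E\odot\mathcal H)$. $\tau$-map: a map $T:E\to E'$ from a Hilbert $\mathcal A$-module to a (pre-)Hilbert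 $\mathcal B$-module with $\langle T(x),T(y)\rangle=\tau(\langle x,y\rangle)$ for all $x,y\in E$. A representation of $\mathcal A$ to $\mathcal B^a(F)$ is a $*$-homomorphism $\mathcal A\to\mathcal B^a(F)$. A map $\Psi:E\to\mathcal B^r(F,F')$ ($E$ a Hilbert $\mathcal A$-module, $F,F'$ inner product $\mathcal B$-modules) is a quasi-representation if there is a $*$-homomorphism $\pi:\mathcal A\to\mathcal B^a(F)$ with $\langle\Psi(y)f_1,\Psi(x)f_2\rangle=\langle\pi(\langle x,y\rangle)f_1,f_2\rangle$ for all $x,y\in E$, $f_1,f_2\in F$; then $\pi$ is said to be associated to $\Psi$. A coisometry $S$ from $E'$ onto $F'$ is an adjointable map $S:E'\to F'$ with $SS^*=1_{F'}$. *)

(* Defs.v *)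
From HB Require Import structures.
From mathcomp Require Import all_boot all_order all_algebra.
From mathcomp Require Import complex.
From mathcomp Require Import all_classical all_reals all_analysis.
Set Implicit Arguments.
Unset Strict Implicit.
Unset Printing Implicit Defensive.
Import Order.TTheory GRing.Theory Num.Theory.
Import numFieldNormedType.Exports.
Local Open Scope classical_set_scope.
Local Open Scope ring_scope.

(* The complex field is [R[i]] for a [realType] [R]. The MathComp norm
   [`|x|] of a normed module over [R[i]] is therefore a (nonnegative real)
   element of [R[i]]. *)

(* Unital C*-algebras, possibly zero (so that a von Neumann algebra may act on
   the zero Hilbert space). The product is a field of the structure because
   Hierarchy Builder does not accept a join of the ring and the normed module
   hierarchies below [numDomainType]. *)
HB.mixin Record isCStarAlgebra (R : realType) A
    of CompleteNormedModule R[i] A := {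
  cmul : A -> A -> A ;
  cone : A ;
  star : A -> A ;
  cmulA : associative cmul ;
  cmul1 : left_id cone cmul ;
  cmulr1 : right_id cone cmul ;
  cmulDl : left_distributive cmul +%R ;
  cmulDr : right_distributive cmul +%R ;
  cmulZl : forall (k : R[i]) (a b : A), cmul (k *: a) b = k *: cmul a b ;
  cmulZr : forall (k : R[i]) (a b : A), cmul a (k *: b) = k *: cmul a b ;
  cnormM : forall a b : A, `|cmul a b| <= `|a| * `|b| ;
  starD : {morph star : a b / a + b} ;
  starZ : forall (k : R[i]) (a : A), star (k *: a) = k^* *: star a ;
  starM : forall a b : A, star (cmul a b) = cmul (star b) (star a) ;
  starK : involutive star ;
  cstar_identity : forall a : A, `|cmul (star a) a| = `|a| ^+ 2
}.

#[short(type="cstarAlgType")]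
HB.structure Definition CStarAlgebra (R : realType) :=
  {A of CompleteNormedModule R[i] A & isCStarAlgebra R A}.

Arguments cone {R s}.
Notation "a ** b" := (cmul a b) (at level 40, left associativity) : ring_scope.

Definition cstar_pos (R : realType) (A : cstarAlgType R) (a : A) : Prop :=
  exists b : A, a = star b ** b.

HB.mixin Record isHilbert (R : realType) H of CompleteNormedModule R[i] H := {
  hdot : H -> H -> R[i] ;
  hdotDr : forall x y z : H, hdot x (y + z) = hdot x y + hdot x z ;
  hdotZr : forall (k : R[i]) (x y : H), hdot x (k *: y) = k * hdot x y ;
  hdotC : forall x y : H, hdot y x = (hdot x y)^* ;
  hdot_norm : forall x : H, hdot x x = `|x| ^+ 2
}.

#[short(type="hilbertType")]
HB.structure Definition Hilbert (R : realType) :=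
  {H of CompleteNormedModule R[i] H & isHilbert R H}.

(* Pre-Hilbert A-modules: definiteness of the A-valued inner product is a
   consequence of [inner_norm]. *)
HB.mixin Record isPreHilbertModule (R : realType) (A : cstarAlgType R) E
    of NormedModule R[i] E := {
  ract : E -> A -> E ;
  inner : E -> E -> A ;
  ractDl : forall (x y : E) (a : A), ract (x + y) a = ract x a + ract y a ;
  ractDr : forall (x : E) (a b : A), ract x (a + b) = ract x a + ract x b ;
  ractZl : forall (k : R[i]) (x : E) (a : A),
    ract (k *: x) a = k *: ract x a ;
  ractZr : forall (k : R[i]) (x : E) (a : A),
    ract x (k *: a) = k *: ract x a ;
  ractM : forall (x : E) (a b : A), ract x (a ** b) = ract (ract x a) b ;
  ract1 : forall x : E, ract x cone = x ;
  innerDr : forall x y z : E, inner x (y + z) = inner x y + inner x z ;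
  innerZr : forall (k : R[i]) (x y : E), inner x (k *: y) = k *: inner x y ;
  inner_ract : forall (x y : E) (a : A), inner x (ract y a) = inner x y ** a ;
  innerC : forall x y : E, inner y x = star (inner x y) ;
  inner_ge0 : forall x : E, cstar_pos (inner x x) ;
  inner_norm : forall x : E, `|inner x x| = `|x| ^+ 2
}.

#[short(type="preHilbertModType")]
HB.structure Definition PreHilbertModule (R : realType) (A : cstarAlgType R) :=
  {E of NormedModule R[i] E & isPreHilbertModule R A E}.

#[short(type="hilbertModType")]
HB.structure Definition HilbertModule (R : realType) (A : cstarAlgType R) :=
  {E of CompleteNormedModule R[i] E & PreHilbertModule R A E}.

(* A type copy of A carrying its structure of Hilbert A-module, with
   inner product (b, c) |-> b^* c. *)
Definition regmod (R : realType) (A : cstarAlgType R) : Type := A.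

Section RegularModule.
Variables (R : realType) (A : cstarAlgType R).

HB.instance Definition _ := CompleteNormedModule.copy (regmod A) A.

Let inner_reg (x y : regmod A) : A := star (x : A) ** (y : A).
Let ract_reg (x : regmod A) (a : A) : regmod A := (x : A) ** a.

Let ractDl_reg x y a : ract_reg (x + y) a = ract_reg x a + ract_reg y a.
Proof. exact: cmulDl. Qed.
Let ractDr_reg x a b : ract_reg x (a + b) = ract_reg x a + ract_reg x b.
Proof. exact: cmulDr. Qed.
Let ractZl_reg (k : R[i]) x a : ract_reg (k *: x) a = k *: ract_reg x a.
Proof. exact: cmulZl. Qed.
Let ractZr_reg (k : R[i]) x a : ract_reg x (k *: a) = k *: ract_reg x a.
Proof. exact: cmulZr. Qed.
Let ractM_reg x a b : ract_reg x (a ** b) = ract_reg (ract_reg x a) b.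
Proof. exact: cmulA. Qed.
Let ract1_reg x : ract_reg x cone = x.
Proof. exact: cmulr1. Qed.
Let innerDr_reg x y z : inner_reg x (y + z) = inner_reg x y + inner_reg x z.
Proof. exact: cmulDr. Qed.
Let innerZr_reg (k : R[i]) x y : inner_reg x (k *: y) = k *: inner_reg x y.
Proof. exact: cmulZr. Qed.
Let inner_ract_reg x y a : inner_reg x (ract_reg y a) = inner_reg x y ** a.
Proof. exact: cmulA. Qed.
Let innerC_reg x y : inner_reg y x = star (inner_reg x y).
Proof. by rewrite /inner_reg starM starK. Qed.
Let inner_ge0_reg x : cstar_pos (inner_reg x x).
Proof. by exists x. Qed.
Let inner_norm_reg x : `|inner_reg x x| = `|x| ^+ 2.
Proof. exact: cstar_identity. Qed.

HB.instance Definition _ := isPreHilbertModule.Build R A (regmod A)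
  ractDl_reg ractDr_reg ractZl_reg ractZr_reg ractM_reg ract1_reg
  innerDr_reg innerZr_reg inner_ract_reg innerC_reg inner_ge0_reg
  inner_norm_reg.

End RegularModule.

Definition bounded_operator (R : realType) (U V : normedModType R[i])
    (f : U -> V) : Prop :=
  linear f /\ exists M : R[i], forall x : U, `|f x| <= M * `|x|.

(* [{ptws H -> K}] carries the topology of pointwise convergence, whose trace
   on the bounded operators is the strong operator topology. *)
Definition strongly_closed (R : realType) (H K : hilbertType R)
    (M : set (H -> K)) : Prop :=
  forall f : H -> K, bounded_operator f ->
    closure (M : set {ptws H -> K}) f -> M f.

(* A von Neumann algebra acting on H, presented as a unital C*-algebra
   together with its inclusion [vn_op] into the bounded operators on H: a
   unital *-homomorphism, isometric for the operator norm (hence injective),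
   with strongly closed range. *)
Record vnAlgType (R : realType) (H : hilbertType R) := VnAlg {
  vn_sort :> cstarAlgType R ;
  vn_op : vn_sort -> H -> H ;
  vn_op_bounded : forall b, bounded_operator (vn_op b) ;
  vn_opD : forall b c h, vn_op (b + c) h = vn_op b h + vn_op c h ;
  vn_opZ : forall (k : R[i]) b h, vn_op (k *: b) h = k *: vn_op b h ;
  vn_opM : forall b c h, vn_op (b ** c) h = vn_op b (vn_op c h) ;
  vn_op1 : forall h, vn_op cone h = h ;
  vn_op_star : forall b h k, hdot (vn_op b h) k = hdot h (vn_op (star b) k) ;
  vn_op_norm_ub : forall b h, `|vn_op b h| <= `|b| * `|h| ;
  vn_op_norm_lub : forall b (M : R[i]), 0 <= M ->
    (forall h, `|vn_op b h| <= M * `|h|) -> `|b| <= M ;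
  vn_op_closed : strongly_closed (range vn_op)
}.
Arguments vn_op {R H B} : rename.

Section Maps.
Variables (R : realType) (A : cstarAlgType R).

Definition is_adjoint (E1 E2 : preHilbertModType A)
    (f : E1 -> E2) (g : E2 -> E1) : Prop :=
  forall x y, inner (f x) y = inner x (g y).

(* The set B^a(E1, E2) of adjointable maps. *)
Record adjointable (E1 E2 : preHilbertModType A) := Adjointable {
  adj_fun :> E1 -> E2 ;
  adj_funP : exists g : E2 -> E1, is_adjoint adj_fun g
}.

Definition adjoint (E1 E2 : preHilbertModType A) (S : adjointable E1 E2) :
  E2 -> E1 := projT1 (cid (adj_funP S)).

Lemma adjointP (E1 E2 : preHilbertModType A) (S : adjointable E1 E2) :
  is_adjoint S (adjoint S).
Proof. exact: projT2 (cid (adj_funP S)). Qed.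

Lemma adjoint_unique (E1 E2 : preHilbertModType A) (f : E1 -> E2)
  (g1 g2 : E2 -> E1) : is_adjoint f g1 -> is_adjoint f g2 -> g1 = g2.
Proof.
move=> h1 h2; apply/funext => y; apply/eqP; rewrite -subr_eq0 -normr_eq0.
have innerBr (x u v : E1) : inner x (u - v) = inner x u - inner x v.
  by rewrite innerDr -scaleN1r innerZr scaleN1r.
set d := g1 y - g2 y.
by rewrite -sqrf_eq0 -inner_norm innerBr -h1 -h2 subrr normr0.
Qed.

(* Membership in B^r(E1, E2). *)
Definition bounded_right_linear (E1 E2 : preHilbertModType A)
    (f : E1 -> E2) : Prop :=
  bounded_operator f /\ forall x a, f (ract x a) = ract (f x) a.

(* A coisometry from E1 onto E2: S S^* is the identity of E2. *)
Definition coisometry (E1 E2 : preHilbertModType A)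
    (S : adjointable E1 E2) : Prop :=
  forall y, S (adjoint S y) = y.

End Maps.

Section Representations.
Variables (R : realType) (A B : cstarAlgType R).

Definition completely_positive (tau : {linear A -> B}) : Prop :=
  forall (n : nat) (a : 'I_n -> A) (b : 'I_n -> B),
    cstar_pos (\sum_(i < n) \sum_(j < n)
      star (b j) ** tau (star (a j) ** a i) ** b i).

Definition tau_map (tau : A -> B) (E : hilbertModType A)
    (E' : preHilbertModType B) (T : E -> E') : Prop :=
  forall x y, inner (T x) (T y) = tau (inner x y).

(* *-homomorphisms A -> B^a(F); they need not be unital. *)
Definition representation (F : preHilbertModType B)
    (pi : A -> adjointable F F) : Prop :=
  [/\ forall a b f, pi (a + b) f = pi a f + pi b f,
      forall (k : R[i]) a f, pi (k *: a) f = k *: pi a f,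
      forall a b f, pi (a ** b) f = pi a (pi b f) &
      forall a f, pi (star a) f = adjoint (pi a) f].

Definition associated (E : hilbertModType A) (F F' : preHilbertModType B)
    (pi : A -> adjointable F F) (Psi : E -> F -> F') : Prop :=
  forall x y f1 f2,
    inner (Psi y f1) (Psi x f2) = inner (pi (inner x y) f1) f2.

Definition quasi_representation (E : hilbertModType A)
    (F F' : preHilbertModType B) (Psi : E -> F -> F') : Prop :=
  (forall x, bounded_right_linear (Psi x)) /\
  exists2 pi : A -> adjointable F F, representation pi & associated pi Psi.

End Representations.

Section VonNeumannModules.
Variables (R : realType) (H : hilbertType R) (B : vnAlgType H).

(* [K], with [t x h] standing for x (.) h, is (a model of) the interior tensor
   product of E and H: the completion of the balanced algebraic tensor product
   for the inner product
     (x1 (.) h1, x2 (.) h2) |-> (h1, <x1, x2> h2).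
   These conditions determine [K] and [t] up to a unique unitary. *)
Record interior_tensor (E : preHilbertModType B) (K : hilbertType R)
    (t : E -> H -> K) : Prop := InteriorTensor {
  itensDl : forall x y h, t (x + y) h = t x h + t y h ;
  itensDr : forall x h k, t x (h + k) = t x h + t x k ;
  itensZl : forall (k : R[i]) x h, t (k *: x) h = k *: t x h ;
  itensZr : forall (k : R[i]) x h, t x (k *: h) = k *: t x h ;
  itens_balanced : forall x (b : B) h, t (ract x b) h = t x (vn_op b h) ;
  itens_dot : forall x1 x2 h1 h2,
    hdot (t x1 h1) (t x2 h2) = hdot h1 (vn_op (inner x1 x2) h2) ;
  itens_dense : dense [set u : K | exists n (x : 'I_n -> E) (h : 'I_n -> H),
    u = \sum_(i < n) t (x i) (h i)]
}.

(* [t] is the map x |-> L_x, so its range is E inside B(H, K). *)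
Definition von_neumann_module (E : preHilbertModType B) : Prop :=
  exists (K : hilbertType R) (t : E -> H -> K),
    interior_tensor t /\ strongly_closed (range t).

End VonNeumannModules.

(* Main.v *)
(* F' = E' and S = id suffice. Let K be the Stinespring space of tau, the
   completion of A (x) H for <a (x) h, b (x) k> = <h, tau(a^* b) k>, and let
   g_a : H -> K be the map h |-> a (x) h. The module F consists of all bounded
   operators f : H -> K such that g_a^* f lies in B for every a; pi(a) and V are
   composition with left multiplication by a, and b |-> g_1 b. If E' is realized
   in B(H, K') by x |-> t'_x, then a (x) h |-> t'_(T(xa)) h extends to a bounded
   operator q_x : K -> K', and Psi(x) is f |-> q_x f.

   What has to be shown is that this is well defined, i.e. that F has a B-valued
   inner product and that q_x F is contained in E'. Both follow from a density
   statement which replaces the double commutant theorem: given operators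
   G_i : H -> K whose ranges span K and with G_i^* G_j in B, every f with all
   G_i^* f in B is a strong limit of sums of operators G_i b. *)
Require Import Defs.
From HB Require Import structures.
From mathcomp Require Import all_boot all_order all_algebra.
From mathcomp Require Import complex ring lra.
From mathcomp Require Import all_classical all_reals all_analysis.
Set Implicit Arguments.
Unset Strict Implicit.
Unset Printing Implicit Defensive.
Import Order.TTheory GRing.Theory Num.Theory.
Import numFieldNormedType.Exports.
Local Open Scope ring_scope.

(** Positivity in B means being of the form b^* b, so a positivity claim has to exhibit a factor b.
    Factors are supplied by a square root of 1 - x, for x a self-adjoint contraction, obtained from
    a norm-convergent iteration instead of spectral theory. It serves twice: to factor f^* f inside
    B, which makes F a pre-Hilbert module, and to factor 1 - d^* d / M^2, which gives the bound
    behind the extensions to K. The operators under pi(a) and q_x are two cases of one extension,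
    for families whose Gram elements are those of left multiplication by some d; for q_x, d is a
    factor of <x, x> = d^* d.

    Complete positivity of tau speaks of tuples in B, whereas the form that defines K is evaluated
    on arbitrary tuples in H. These are split along cyclic subspaces, whose vectors are limits of
    vectors b eta.

    The inclusion of q_x F in E' goes through the adjoint: q_x^* maps E' into F, so t'_z^* q_x f is
    an inner product of two elements of F and lies in B. Self-duality of E' then yields an element
    representing q_x f. *)

Section RealNorm.
Variable R : realType.
Implicit Types (x y : R) (z w : R[i]).

Lemma ReD z w : complex.Re (z + w) = complex.Re z + complex.Re w.
Proof. by case: z w => a b [c d]. Qed.

Lemma ReN z : complex.Re (- z) = - complex.Re z.
Proof. by case: z. Qed.

Lemma ReB z w : complex.Re (z - w) = complex.Re z - complex.Re w.
Proof. by rewrite ReD ReN. Qed.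

Lemma Re_realM x z : complex.Re (x%:C%C * z) = x * complex.Re z.
Proof. by case: z => a b /=; rewrite mul0r subr0. Qed.

(** Two conjugations coexist on [R[i]]. Both multiply [z] to its squared modulus, so [z] can be
    cancelled. *)
Lemma conjE z : z^* = (z^*)%C.
Proof.
have [->|z0] := eqVneq z 0; first by rewrite conjC0 conjc0.
by apply: (mulfI z0); rewrite -normCK sqr_normc.
Qed.

Lemma conjD z w : (z + w)^* = z^* + w^*.
Proof. exact: rmorphD. Qed.

Lemma conjM z w : (z * w)^* = z^* * w^*.
Proof. exact: rmorphM. Qed.

Lemma cRe_conj z : complex.Re z^* = complex.Re z.
Proof. by rewrite conjE; case: z. Qed.

Lemma conj_real x : (x%:C%C : R[i])^* = x%:C%C.
Proof. by rewrite conjE conjc_real. Qed.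

Lemma ge0_ReE z : 0 <= z -> z = (complex.Re z)%:C%C.
Proof. by case: z => a b; rewrite lecE /= => /andP[/eqP -> _]. Qed.

Lemma ge0_Re z : 0 <= z -> 0 <= complex.Re z.
Proof. by case: z => a b; rewrite lecE /= => /andP[]. Qed.

(** Norms take values in [R[i]], which is only partially ordered; the real part moves every estimate
    to the ordered field [R], where [lra] and [nra] apply. *)
Definition nrm (V : normedZmodType R[i]) (v : V) : R := complex.Re `|v|.

Section Normed.
Variable V : normedZmodType R[i].
Implicit Types u v : V.

Lemma nrmE v : `|v| = (nrm v)%:C%C.
Proof. exact: ge0_ReE. Qed.

Lemma nrm_ge0 v : 0 <= nrm v.
Proof. exact: ge0_Re. Qed.

Lemma nrm0 : nrm (0 : V) = 0.
Proof. by rewrite /nrm normr0. Qed.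

Lemma nrm_eq0 v : nrm v = 0 -> v = 0.
Proof. by move=> v0; apply: normr0_eq0; rewrite nrmE v0. Qed.

Lemma nrmD u v : nrm (u + v) <= nrm u + nrm v.
Proof. by have := ler_normD u v; rewrite !nrmE -rmorphD lecR. Qed.

Lemma nrmN v : nrm (- v) = nrm v.
Proof. by rewrite /nrm normrN. Qed.

Lemma nrmBC u v : nrm (u - v) = nrm (v - u).
Proof. by rewrite /nrm distrC. Qed.

Lemma nrm_sum n (F : 'I_n -> V) : nrm (\sum_i F i) <= \sum_i nrm (F i).
Proof.
elim/big_ind2: _ => [|a b c d ab cd|//]; first by rewrite nrm0.
by apply: le_trans (nrmD _ _) _; rewrite lerD.
Qed.

Lemma nrm_le v x : (nrm v <= x) = (`|v| <= x%:C%C).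
Proof. by rewrite nrmE lecR. Qed.

Lemma nrm_lt v x : (nrm v < x) = (`|v| < x%:C%C).
Proof. by rewrite nrmE ltcR. Qed.

Lemma nrm_eq0_small v : (forall e, 0 < e -> nrm v <= e) -> v = 0.
Proof.
move=> small; apply: nrm_eq0; apply/eqP; rewrite eq_le nrm_ge0 andbT.
by apply/ler_addgt0Pr => e e0; rewrite add0r small.
Qed.

End Normed.

Lemma nrmZ (V : normedModType R[i]) z (v : V) : nrm (z *: v) = nrm z * nrm v.
Proof. by rewrite /nrm normrZ nrmE Re_realM. Qed.

Lemma nrmM z w : nrm (z * w) = nrm z * nrm w.
Proof. by rewrite /nrm normrM nrmE Re_realM. Qed.

Lemma nrm_conj z : nrm z^* = nrm z.
Proof. by rewrite /nrm norm_conjC. Qed.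

Lemma nrm_real x : nrm (x%:C%C : R[i]) = `|x|.
Proof. by rewrite /nrm normc_def /= expr0n addr0 sqrtr_sqr. Qed.

Lemma Re_nrm z : complex.Re z <= nrm z.
Proof.
have := normc_ge_Re z; rewrite nrmE lecR; exact/le_trans/ler_norm.
Qed.

Lemma normRe_nrm z : `|complex.Re z| <= nrm z.
Proof. by have := normc_ge_Re z; rewrite nrmE lecR. Qed.

Lemma nrm_i : nrm ('i%C : R[i]) = 1.
Proof. by rewrite /nrm normc_def /= expr0n add0r expr1n sqrtr1. Qed.

Lemma normIm_nrm z : `|complex.Im z| <= nrm z.
Proof.
by have := normRe_nrm (z * 'i%C); rewrite ReiNIm normrN nrmM nrm_i mulr1.
Qed.

Lemma ImB z w : complex.Im (z - w) = complex.Im z - complex.Im w.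
Proof. by case: z w => a b [c d]. Qed.

Lemma mul_conj z : z * z^* = ((nrm z) ^+ 2)%:C%C.
Proof. by rewrite -normCK nrmE rmorphXn. Qed.

End RealNorm.

(* V is a bare type and comb k v w stands for k v + w: this lets V be a type of
   formal sums, on which comb satisfies no algebraic law. *)
Record semi_inner (R : realType) (V : Type) (comb : R[i] -> V -> V -> V)
    (s : V -> V -> R[i]) : Prop := SemiInner {
  si_lin : forall u k v w, s u (comb k v w) = k * s u v + s u w ;
  si_sym : forall v w, s w v = (s v w)^* ;
  si_ge0 : forall v, 0 <= s v v
}.

Definition comb_linear (R : realType) (V : Type) (comb : R[i] -> V -> V -> V)
    (W : lmodType R[i]) (f : V -> W) : Prop :=
  forall k v w, f (comb k v w) = k *: f v + f w.

(** The minimum of the parabola is at t = 1/S. If S = 0 it degenerates to a line of slope -2D, which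
    stays nonnegative only for D = 0: otherwise t = (T + 1)/D gives -T - 2, with T >= 0 by t = 0. *)
Lemma quadratic_bound (R : realType) (S D T : R) : 0 <= S -> 0 <= D ->
  (forall t, 0 <= t ^+ 2 * D * S - 2 * t * D + T) -> D <= T * S.
Proof.
move=> S0 D0 H; have [S1|S1] := eqVneq S 0.
  have [->|D1] := eqVneq D 0; first by rewrite S1 mulr0.
  have := H ((T + 1) / D); have T0 := H 0.
  rewrite S1 -[2 * _ * D]mulrA mulfVK// mulr0; lra.
have Sp : 0 < S by rewrite lt_def S1.
have := H S^-1.
have -> : S^-1 ^+ 2 * D * S = D / S by field.
have -> : 2 * S^-1 * D = 2 * (D / S) by field.
move=> h; rewrite -ler_pdivrMr//; lra.
Qed.

(** * Riesz representation without completeness *)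

Section SemiInner.
Variables (R : realType) (V : Type) (comb : R[i] -> V -> V -> V).
Variable s : V -> V -> R[i].
Hypothesis sP : semi_inner comb s.

Definition snorm (v : V) : R := Num.sqrt (complex.Re (s v v)).

Lemma snorm_ge0 v : 0 <= snorm v.
Proof. exact: sqrtr_ge0. Qed.

Lemma snorm_sqr v : snorm v ^+ 2 = complex.Re (s v v).
Proof. by rewrite sqr_sqrtr// ge0_Re// (si_ge0 sP). Qed.

Lemma si_linl u k v w : s (comb k v w) u = k^* * s v u + s w u.
Proof.
by rewrite (si_sym sP) (si_lin sP) conjD conjM -!(si_sym sP).
Qed.

Section Functional.
Variable phi : V -> R[i].
Hypothesis phi_lin : forall k v w, phi (comb k v w) = k * phi v + phi w.

(** If [phi] is the product with a vector p, this is |v - p|^2 - |p|^2, so minimizing [q] approaches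
    p even when p is missing from [V]. *)
Let q v := complex.Re (s v v) - 2 * complex.Re (phi v).

Let q_comb k v w :
  q (comb k w v) = nrm k ^+ 2 * complex.Re (s w w)
    + 2 * complex.Re (k * (s v w - phi w)) + q v.
Proof.
rewrite /q (si_lin sP) !si_linl phi_lin mulrDr mulrA mul_conj.
rewrite (si_sym sP v w) mulrBr.
rewrite -conjM !ReD cRe_conj Re_realM ReN; ring.
Qed.

(** Moving [v] by t z^* w, with z the defect of [v] at [w], changes [q] by t^2 |z|^2 s(w, w) - 2 t
    |z|^2. This is at least -d for all t, and [quadratic_bound] applies. *)
Lemma almost_minimizer v (d : R) w :
  (forall u, q v - d <= q u) ->
  nrm (phi w - s v w) ^+ 2 <= d * complex.Re (s w w).
Proof.
move=> qv; set z := phi w - s v w; apply: quadratic_bound.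
- exact/ge0_Re/(si_ge0 sP).
- exact: exprn_ge0 (nrm_ge0 _).
move=> t; have := qv (comb (t%:C%C * z^*) w v).
rewrite q_comb -[s v w - _]opprB -/z mulrN ReN -(mulrA _ _ z) Re_realM.
rewrite [z^* * z]mulrC mul_conj nrmM nrm_conj nrm_real exprMn real_normK ?num_real//=.
lra.
Qed.

(** Completing the square bounds [q] below by -M^2, and a vector within d^2 of the infimum will do.
    An exact representative need not exist in [V]; it appears later as a limit in a complete
    space. *)
Lemma approximate_Riesz (v0 : V) (M : R) :
  (forall v, nrm (phi v) <= M * snorm v) ->
  forall d : R, 0 < d -> exists v, forall w, nrm (phi w - s v w) <= d * snorm w.
Proof.
move=> phiM d d0; pose E := [set q v | v in [set: V]]%classic.
have infE : has_inf E.
  split; first by exists (q v0), v0.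
  exists (- M ^+ 2) => _ [v _ <-]; rewrite /q -snorm_sqr.
  have := phiM v; have := Re_nrm (phi v); have := sqr_ge0 (snorm v - M); rewrite sqrrB.
  lra.
have [_ [v _ <-] vE] := @inf_adherent _ E (d ^+ 2) (exprn_gt0 _ d0) infE.
exists v => w; rewrite -ler_sqr ?nnegrE ?nrm_ge0 ?mulr_ge0 ?snorm_ge0 ?(ltW d0)//.
rewrite exprMn snorm_sqr; apply: almost_minimizer => u.
rewrite lerBlDr (le_trans (ltW vE))// lerD2r.
by apply: ge_inf; [case: infE | exists u].
Qed.

End Functional.

(** This is [almost_minimizer] for the zero functional: [q] is then the squared norm, which every
    [v] minimizes up to s(v, v). *)
Lemma si_CS v w : nrm (s v w) <= snorm v * snorm w.
Proof.
rewrite -ler_sqr ?nnegrE ?nrm_ge0 ?mulr_ge0 ?snorm_ge0// exprMn !snorm_sqr.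
have := @almost_minimizer (fun=> 0) _ v (complex.Re (s v v)) w.
rewrite sub0r nrmN; apply=> [k u x|u]; first by rewrite mulr0 addr0.
by rewrite mulr0 !subr0 subrr; exact/ge0_Re/(si_ge0 sP).
Qed.

Lemma snorm_comb k v w : snorm (comb k v w) <= nrm k * snorm v + snorm w.
Proof.
rewrite -ler_sqr ?nnegrE ?addr_ge0 ?mulr_ge0 ?snorm_ge0 ?nrm_ge0//.
rewrite sqrrD exprMn !snorm_sqr (si_lin sP) !si_linl mulrDr mulrA mul_conj.
have h : complex.Re (k * s w v) <= nrm k * (snorm v * snorm w).
  apply: le_trans (Re_nrm _) _; rewrite nrmM ler_wpM2l ?nrm_ge0//.
  by rewrite mulrC si_CS.
have -> : s v w = (s w v)^* by rewrite -(si_sym sP).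
rewrite -conjM !ReD cRe_conj Re_realM; lra.
Qed.

End SemiInner.

(** * Limits with explicit error bounds *)

Section Limits.
Variable R : realType.

Definition vanishing (a : nat -> R) : Prop :=
  forall e, 0 < e -> exists N, forall n, (N <= n)%N -> a n <= e.

Definition delta (n : nat) : R := n.+1%:R^-1.

Lemma delta_gt0 n : 0 < delta n.
Proof. by rewrite invr_gt0 ltr0n. Qed.

Lemma vanishing_delta (c : R) : 0 <= c -> vanishing (fun n => c * delta n).
Proof.
move=> c0 e e0; exists (Num.bound (c / e)) => n Nn.
rewrite ler_pdivrMr ?ltr0n// mulrC -ler_pdivrMr//.
have /ltW/le_trans := archi_boundP (divr_ge0 c0 (ltW e0)); apply.
by rewrite ler_nat (leq_trans Nn).
Qed.

Lemma vanishing_le (a : nat -> R) (x y : R) :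
  vanishing a -> (forall n, x <= y + a n) -> x <= y.
Proof.
move=> a0 xy; apply/ler_addgt0Pr => e e0; have [N aN] := a0 e e0.
by apply: le_trans (xy N) _; rewrite lerD2l aN.
Qed.

(** The intervals [u m - a m, u m + a m] meet pairwise, so the supremum of their left ends belongs
    to all of them. *)
Lemma real_limit (u a : nat -> R) :
  (forall m n, `|u m - u n| <= a m + a n) ->
  exists l, forall m, `|u m - l| <= a m.
Proof.
move=> ua; pose E := [set u m - a m | m in [set: nat]]%classic.
have ub n : ubound E (u n + a n).
  move=> _ [m _ <-]; have := ua m n; rewrite ler_norml => /andP[_]; lra.
exists (sup E) => m; rewrite ler_norml.
have h1 : sup E <= u m + a m by apply: ge_sup; [exists (u 0%N - a 0%N), 0%N | exact: ub].
have h2 : u m - a m <= sup E.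
  by apply: ub_le_sup; [exists (u 0%N + a 0%N); exact: ub | exists m].
by apply/andP; split; lra.
Qed.

(** The factor 2 adds the errors of the real and imaginary parts. *)
Lemma complex_limit (u : nat -> R[i]) (a : nat -> R) :
  (forall m n, nrm (u m - u n) <= a m + a n) ->
  exists l, forall m, nrm (u m - l) <= 2 * a m.
Proof.
move=> ua.
have [m n|x xP] := @real_limit (fun n => complex.Re (u n)) a.
  by rewrite -ReB (le_trans (normRe_nrm _)).
have [m n|y yP] := @real_limit (fun n => complex.Im (u n)) a.
  by rewrite -ImB (le_trans (normIm_nrm _)).
exists (Complex x y) => m.
have -> : u m - Complex x y
    = (complex.Re (u m) - x)%:C%C + 'i%C * (complex.Im (u m) - y)%:C%C.
  by rewrite [LHS]complexE /=; case: (u m).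
apply: le_trans (nrmD _ _) _; rewrite nrmM !nrm_real nrm_i.
by rewrite mul1r mulr2n mulrDl mul1r lerD.
Qed.

Lemma gt0_ReE (e : R[i]) : 0 < e -> 0 < complex.Re e /\ e = (complex.Re e)%:C%C.
Proof.
by move=> e0; have e1 := ge0_ReE (ltW e0); split=> //; move: e0; rewrite e1 ltcR.
Qed.

Lemma complete_limit (K : completeNormedModType R[i]) (u : nat -> K)
    (a : nat -> R) : vanishing a ->
  (forall m n, nrm (u m - u n) <= a m + a n) ->
  exists l, forall m, nrm (u m - l) <= a m.
Proof.
move=> a0 ua.
have /cauchy_cvg : cauchy (u @ \oo)%classic.
  apply/cauchy_exP => e /gt0_ReE[e0 ->].
  have [N aN] := a0 (complex.Re e / 4) (divr_gt0 e0 (ltr0n _ 4)).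
  exists (u N); exists N => // n /= Nn; rewrite -ball_normE /= -nrm_lt.
  apply: le_lt_trans (ua _ _) _; have := aN _ Nn; have := aN _ (leqnn N); lra.
move=> /cvg_ex[l /cvgrPdist_lt ul]; exists l => m.
apply/ler_addgt0Pr => e e0.
have [N aN] := a0 (e / 2) (divr_gt0 e0 (ltr0n _ 2)).
have [|N' _ uN] := ul (e / 2)%:C%C; first by rewrite ltcR divr_gt0.
have := uN (maxn N N') (leq_maxr _ _); rewrite /= -nrm_lt nrmBC => h1.
have := ua m (maxn N N'); have := aN _ (leq_maxl N N').
move=> h2 h3; rewrite -(subrKA (u (maxn N N')) (u m) (- l)).
by apply: le_trans (nrmD _ _) _; lra.
Qed.

End Limits.

(** * Completion of a semi-inner product *)

Section Completion.
Variables (R : realType) (V : Type) (comb : R[i] -> V -> V -> V).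
Variable s : V -> V -> R[i].

Definition bounded_by (M : R) (f : V -> R[i]) : Prop :=
  0 <= M /\ forall v, nrm (f v) <= M * snorm s v.

(** A vector f of the completion is encoded by w |-> <w, f>, which is the Riesz identification taken
    as a definition: null vectors are identified without a quotient, and antilinearity in w makes
    the embedding of [V] linear. *)
Definition antifunctional : {pred V -> R[i]^o} := fun f =>
  `[< (forall k v w, f (comb k v w) = k^* * f v + f w) /\
      exists M, bounded_by M f >].

(* The arguments sP and v do not occur in the fields: the instances below are
   declared on the type and depend on them. *)
Record completion (sP : semi_inner comb s) (v : V) := Completion {
  cfun :> V -> R[i]^o ;
  cfunP : cfun \in antifunctional }.

Variables (sP : semi_inner comb s) (v0 : V).

HB.instance Definition _ := [isSub of completion sP v0 for @cfun sP v0].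
HB.instance Definition _ := [Choice of completion sP v0 by <:].

Lemma bounded_byD M N f g :
  bounded_by M f -> bounded_by N g -> bounded_by (M + N) (f \+ g).
Proof.
move=> [M0 fM] [N0 gN]; split=> [|v /=]; first exact: addr_ge0.
by rewrite mulrDl (le_trans (nrmD _ _))// lerD.
Qed.

Lemma bounded_byZ M (k : R[i]) f :
  bounded_by M f -> bounded_by (nrm k * M) (fun v => k * f v).
Proof.
move=> [M0 fM]; split=> [|v /=]; first by rewrite mulr_ge0 ?nrm_ge0.
by rewrite nrmM -mulrA ler_wpM2l ?nrm_ge0.
Qed.

Lemma antifunctional_submod : submod_closed antifunctional.
Proof.
split.
  apply/asboolP; split=> [k v w|]; first by rewrite mulr0 addr0.
  by exists 0; split=> // v; rewrite mul0r nrm0.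
move=> k f g /asboolP[f1 [M fM]] /asboolP[g1 [N gN]]; apply/asboolP; split.
  move=> l v w /=; rewrite !fctE f1 g1 /GRing.scale/=; ring.
by exists (nrm k * M + N); exact: bounded_byD (bounded_byZ _ fM) gN.
Qed.

HB.instance Definition _ :=
  GRing.isSubmodClosed.Build R[i] (V -> R[i]^o) antifunctional
    antifunctional_submod.
HB.instance Definition _ := [SubChoice_isSubLmodule of completion sP v0 by <:].

Local Notation K := (completion sP v0).
Implicit Types f g h : K.

Lemma cfun_comb f k v w : f (comb k v w) = k^* * f v + f w.
Proof. by have /asboolP[f1 _] := cfunP f; exact: f1. Qed.

Lemma cfun_bounded f : exists M, bounded_by M f.
Proof. by have /asboolP[] := cfunP f. Qed.

Lemma cfunD f g v : (f + g) v = f v + g v.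
Proof. by []. Qed.

Lemma cfunZ k f v : (k *: f) v = k * f v.
Proof. by []. Qed.

Lemma cfun_inj f g : (forall v, f v = g v) -> f = g.
Proof. by move=> fg; apply: val_inj; apply/funext => v; exact: fg. Qed.

(** The dual-norm distance from [f] to the vector [v] is at most [d], expressed before the
    completion has a norm. *)
Definition near_form (d : R) f v : Prop :=
  0 <= d /\ forall w, nrm (f w - s w v) <= d * snorm s w.

Lemma near_form_exists f d : 0 < d -> exists v, near_form d f v.
Proof.
move=> d0; have [M [M0 fM]] := cfun_bounded f.
have [k v w|v|v vP] :=
    @approximate_Riesz R V comb s sP (fun v => (f v)^*) _ v0 M _ d d0.
- by rewrite cfun_comb conjD conjM conjCK.
- by rewrite nrm_conj.
exists v; split=> [|w]; first exact: ltW.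
by rewrite -nrm_conj rmorphB/= -(si_sym sP).
Qed.

(** For u = v' - v, the square <u, u> is the difference of the two defects at u, so |u| <= d + d';
    then [g] is applied to u. *)
Lemma near_form_dist f g d d' v v' M : near_form d f v -> near_form d' f v' ->
  bounded_by M g -> nrm (g v - g v') <= M * (d + d').
Proof.
move=> [d0 fv] [d'0 fv'] [M0 gM]; set u := comb (- 1) v v'.
have -> : g v - g v' = - g u.
  by rewrite cfun_comb rmorphN rmorph1 mulN1r opprD opprK.
rewrite nrmN (le_trans (gM _))// ler_wpM2l//.
have [|u0] := leP (snorm s u) 0; first by move=> u0; rewrite (le_trans u0)// addr_ge0.
rewrite -(ler_pM2r u0) -expr2 (snorm_sqr sP).
apply: le_trans (Re_nrm _) _.
have -> : s u u = (f u - s u v) - (f u - s u v').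
  rewrite {2}/u (si_lin sP); ring.
apply: le_trans (nrmD _ _) _; rewrite nrmN mulrDl lerD//.
Qed.

Lemma near_form_norm f d v M :
  near_form d f v -> bounded_by M f -> snorm s v <= M + d.
Proof.
move=> [d0 fv] [M0 fM].
have [|u0] := leP (snorm s v) 0; first by move=> u0; rewrite (le_trans u0)// addr_ge0.
rewrite -(ler_pM2r u0) -expr2 (snorm_sqr sP).
apply: le_trans (Re_nrm _) _; rewrite -[s v v](subKr (f v)).
by apply: le_trans (nrmD _ _) _; rewrite nrmN mulrDl lerD.
Qed.

(** The product has to be the limit of [g v] as [v] approaches [f]. Asking for the estimate at all
    [d], [v] and [M] frees the value from the sequence chosen to construct it. *)
Lemma cdot_exists f g : exists z : R[i], forall d v M,
  near_form d f v -> bounded_by M g -> nrm (z - g v) <= M * d.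
Proof.
have /choice[x xP] n := near_form_exists f (delta_gt0 R n).
have [N gN] := cfun_bounded g; have [N0 _] := gN.
have [m n|z zP] := @complex_limit R (fun n => g (x n)) (fun n => N * delta R n).
  by rewrite -mulrDr; apply: near_form_dist gN; apply: xP.
exists z => d v M fv gM; have [M0 _] := gM.
apply: (@vanishing_le R (fun n => (2 * N + M) * delta R n)).
  by apply: vanishing_delta; rewrite addr_ge0// mulr_ge0.
move=> n; rewrite -(subrKA (g (x n))); apply: le_trans (nrmD _ _) _.
have := zP n; rewrite nrmBC; have := near_form_dist (xP n) fv gM; lra.
Qed.

Definition cdot f g : R[i] := projT1 (cid (cdot_exists f g)).

Lemma cdotP f g d v M :
  near_form d f v -> bounded_by M g -> nrm (cdot f g - g v) <= M * d.
Proof. exact: (projT2 (cid (cdot_exists f g))). Qed.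

(** Uniqueness of that limit, in the form used to verify each identity of the product. The
    restriction d <= 1 allows quadratic errors to be absorbed in [C]. *)
Lemma cdot_eq f g z (C : R) :
  (forall d v, 0 < d -> d <= 1 -> near_form d f v -> nrm (z - g v) <= C * d) ->
  cdot f g = z.
Proof.
move=> zP; have [M gM] := cfun_bounded g; have [M0 _] := gM.
have C0 : 0 <= C.
  have [v fv] := near_form_exists f ltr01.
  have := zP _ _ ltr01 (lexx _) fv; have := nrm_ge0 (z - g v); lra.
apply/eqP; rewrite -subr_eq0; apply/eqP/nrm_eq0_small => e e0.
have C1 : 0 < M + C + 1 by lra.
pose d := Num.min 1 (e / (M + C + 1)).
have d0 : 0 < d by rewrite lt_min ltr01 divr_gt0.
have d1 : d <= 1 by rewrite ge_min lexx.
have d2 : d * (M + C + 1) <= e by rewrite -ler_pdivlMr// ge_min lexx orbT.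
have [v fv] := near_form_exists f d0.
have h1 := cdotP fv gM; have := zP _ _ d0 d1 fv; rewrite nrmBC => h2.
rewrite -(subrKA (g v)); apply: le_trans (nrmD _ _) _; nra.
Qed.

Lemma cdotDr f g h : cdot f (g + h) = cdot f g + cdot f h.
Proof.
have [M gM] := cfun_bounded g; have [N hN] := cfun_bounded h.
apply: (@cdot_eq _ _ _ (M + N)) => d v _ _ fv.
rewrite cfunD opprD addrACA mulrDl; apply: le_trans (nrmD _ _) _.
by rewrite lerD ?(cdotP fv).
Qed.

Lemma cdotZr k f g : cdot f (k *: g) = k * cdot f g.
Proof.
have [M gM] := cfun_bounded g.
apply: (@cdot_eq _ _ _ (nrm k * M)) => d v _ _ fv.
by rewrite cfunZ -mulrBr nrmM -mulrA ler_wpM2l ?nrm_ge0// (cdotP fv).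
Qed.

Lemma cdotC f g : cdot g f = (cdot f g)^*.
Proof.
have [M fM] := cfun_bounded f; have [N gN] := cfun_bounded g.
have [M0 _] := fM; have [N0 _] := gN.
apply: (@cdot_eq _ _ _ (N + (M + 1) + (N + 1))) => d w d0 d1 gw.
have [v fv] := near_form_exists f d0.
have h1 := cdotP fv gN.
have h2 : nrm (g v - s v w) <= (M + 1) * d.
  have := near_form_norm fv fM; have [_ /(_ v)] := gw; nra.
have h3 : nrm (f w - s w v) <= (N + 1) * d.
  have := near_form_norm gw gN; have [_ /(_ w)] := fv; nra.
rewrite -nrm_conj rmorphB/= conjCK.
rewrite -(subrKA (g v)) -(subrKA (s v w) (g v)).
apply: le_trans (nrmD _ _) _.
apply: le_trans (lerD (lexx _) (nrmD _ _)) _.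
have : nrm (s v w - (f w)^*) <= (N + 1) * d.
  by rewrite -nrm_conj rmorphB/= conjCK -(si_sym sP) nrmBC.
lra.
Qed.

Lemma cdot_ge0 f : 0 <= cdot f f.
Proof.
have [M fM] := cfun_bounded f; have [M0 _] := fM.
have : (cdot f f)^* = cdot f f by rewrite -cdotC.
rewrite conjE; case E : (cdot f f) => [x y] /= [yN].
rewrite lecE /= eq_sym (_ : y = 0) ?eqxx /=; last by lra.
apply/ler_addgt0Pr => e e0.
pose d := Num.min 1 (e / (2 * M + 1)).
have M1 : 0 < 2 * M + 1 by lra.
have d0 : 0 < d by rewrite lt_min ltr01 divr_gt0.
have d1 : d <= 1 by rewrite ge_min lexx.
have d2 : d * (2 * M + 1) <= e by rewrite -ler_pdivlMr// ge_min lexx orbT.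
have [v fv] := near_form_exists f d0.
have h1 := cdotP fv fM; have h2 := near_form_norm fv fM; have [_ /(_ v) h3] := fv.
have := ge0_Re (si_ge0 sP v).
have := le_trans (normRe_nrm _) h1; rewrite ReB E ler_norml /= => /andP[h4 _].
have := le_trans (normRe_nrm _) h3; rewrite ReB ler_norml => /andP[h5 _].
nra.
Qed.

Lemma antifunctional_form v : (fun w => s w v) \in antifunctional.
Proof.
apply/asboolP; split=> [k u w|]; first by rewrite (si_linl sP).
exists (snorm s v); split=> [|w]; first exact: snorm_ge0.
by rewrite mulrC (si_CS sP).
Qed.

Definition ciota v : K := Completion sP v0 (antifunctional_form v).

Lemma cdot_ciota v g : cdot (ciota v) g = g v.
Proof.
have [M gM] := cfun_bounded g.
have /cdotP-/(_ _ _ gM) : near_form 0 (ciota v) v.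
  by split=> // w; rewrite subrr nrm0 mul0r.
rewrite mulr0 => h; apply/eqP; rewrite -subr_eq0; apply/eqP/nrm_eq0/eqP.
by rewrite eq_le h nrm_ge0.
Qed.

Lemma cdot_semi_inner : semi_inner (fun k f g => k *: f + g) cdot.
Proof.
split=> [f k g h|f g|f]; [by rewrite cdotDr cdotZr|exact: cdotC|exact: cdot_ge0].
Qed.

Local Notation cnorm := (snorm cdot).

(** Cauchy-Schwarz against the embedded vector, whose product with [f] evaluates [f]. With
    [cnorm_le] it identifies the Hilbert norm and the dual norm. *)
Lemma cfun_le f v : nrm (f v) <= cnorm f * snorm s v.
Proof.
have := si_CS cdot_semi_inner (ciota v) f.
by rewrite cdot_ciota mulrC {2}/snorm cdot_ciota.
Qed.

Lemma cnorm_le M f : bounded_by M f -> cnorm f <= M.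
Proof.
move=> fM; have [M0 _] := fM.
rewrite -ler_sqr ?nnegrE ?snorm_ge0// (snorm_sqr cdot_semi_inner).
apply: (@vanishing_le R (fun n => (2 * M) * delta R n)).
  by apply: vanishing_delta; rewrite mulr_ge0.
move=> n; have [v fv] := near_form_exists f (delta_gt0 R n).
have h1 := cdotP fv fM; have h2 := near_form_norm fv fM.
have [_ /(_ v) h3] := fM.
apply: le_trans (Re_nrm _) _; rewrite -(subrK (f v) (cdot f f)).
apply: le_trans (nrmD _ _) _; nra.
Qed.

Lemma cnormZ (k : R[i]) f : cnorm (k *: f) = nrm k * cnorm f.
Proof.
rewrite /snorm cdotZr cdotC cdotZr conjM -cdotC mulrA mul_conj Re_realM.
by rewrite sqrtrM ?sqr_ge0// sqrtr_sqr ger0_norm ?nrm_ge0.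
Qed.

Let knorm f : R[i] := (cnorm f)%:C%C.

Let knormD f g : knorm (f + g) <= knorm f + knorm g.
Proof.
have := snorm_comb cdot_semi_inner 1 f g.
rewrite scale1r (_ : nrm (1 : R[i]) = 1) ?mul1r; last by rewrite /nrm normr1.
by rewrite /knorm -rmorphD lecR.
Qed.

Let knormZ (k : R[i]) f : knorm (k *: f) = `|k| * knorm f.
Proof. by rewrite /knorm cnormZ rmorphM nrmE. Qed.

Let knorm_eq0 f : knorm f = 0 -> f = 0.
Proof.
move=> /complexI f0; apply: cfun_inj => v; apply: nrm_eq0; apply/eqP.
by rewrite eq_le nrm_ge0 (le_trans (cfun_le _ _))// f0 mul0r.
Qed.

HB.instance Definition _ :=
  Lmodule_isNormed.Build R[i] K knormD knormZ knorm_eq0.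

Lemma completion_nrmE f : nrm f = cnorm f.
Proof. by []. Qed.


Lemma completion_dense f (d : R) : 0 < d -> exists v, nrm (f - ciota v) <= d.
Proof.
move=> /(near_form_exists f)[v fv]; have [d0 fvP] := fv.
by exists v; apply: cnorm_le; split=> // w; exact: fvP.
Qed.

(** The limit is taken pointwise on [V]. Its defect of antilinearity is that of l - x N, hence
    arbitrarily small, and the pointwise error, proportional to [snorm s w], is an error in dual
    norm. *)
Lemma completion_seq_limit (x : nat -> K) (a : nat -> R) : vanishing a ->
  (forall n, 0 <= a n) ->
  (forall m n, nrm (x m - x n) <= a m + a n) ->
  exists l, forall n, nrm (x n - l) <= 2 * a n.
Proof.
move=> a0 a_ge0 xP.
have /choice[l lP] v : exists z : R[i], forall n,
    nrm (x n v - z) <= 2 * (a n * snorm s v).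
  apply: complex_limit => m n; rewrite -mulrDl.
  apply: le_trans (cfun_le (x m - x n) v) _.
  by apply: ler_wpM2r; [exact: snorm_ge0 | exact: xP].
have xl n w : nrm (x n w - l w) <= 2 * a n * snorm s w by rewrite -mulrA.
have lA : (l : V -> R[i]^o) \in antifunctional.
  apply/asboolP; split=> [k v w|]; last first.
    exists (2 * a 0%N + cnorm (x 0%N)); split=> [|v].
      by rewrite addr_ge0 ?mulr_ge0 ?snorm_ge0.
    rewrite -[l v](subKr (x 0%N v)) mulrDl addrC; apply: le_trans (nrmD _ _) _.
    by rewrite nrmN lerD ?cfun_le.
  apply/eqP; rewrite -subr_eq0; apply/eqP/nrm_eq0/eqP.
  rewrite eq_le nrm_ge0 andbT.
  set C := snorm s (comb k v w) + nrm k * snorm s v + snorm s w.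
  have C0 : 0 <= C by rewrite !addr_ge0 ?mulr_ge0 ?snorm_ge0 ?nrm_ge0.
  apply/ler_addgt0Pr => e e0.
  have C1 : 0 < 2 * (C + 1) by rewrite mulr_gt0 ?ltr_wpDl.
  have [N aN] := a0 (e / (2 * (C + 1))) (divr_gt0 e0 C1).
  have := aN N (leqnn N); rewrite ler_pdivlMr ?mulr_gt0 ?ltr_wpDl// => aC.
  have -> : l (comb k v w) - (k^* * l v + l w) =
     - (x N (comb k v w) - l (comb k v w)) + (k^* * (x N v - l v) + (x N w - l w)).
    rewrite cfun_comb; ring.
  have h1 := xl N (comb k v w); have h2 := xl N v; have h3 := xl N w.
  rewrite add0r; apply: le_trans (nrmD _ _) _; rewrite nrmN.
  apply: le_trans (lerD (lexx _) (nrmD _ _)) _; rewrite nrmM nrm_conj.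
  have := ler_wpM2l (nrm_ge0 k) h2; have := a_ge0 N; rewrite /C in aC; nra.
exists (Completion sP v0 lA) => n; apply: cnorm_le; split=> [|w]; last exact: xl.
exact: mulr_ge0.
Qed.

Lemma completion_complete (F : set_system K) :
  ProperFilter F -> cauchy F -> cvg F.
Proof.
move=> PF /cauchyP cF.
have /choice[x xF] n : exists x, F (ball x (delta R n)%:C%C).
  by apply: cF; rewrite ltcR delta_gt0.
have dl := @vanishing_delta R 1 ler01.
have [n| m n|l lP] := @completion_seq_limit x _ dl.
- by rewrite mul1r ltW// delta_gt0.
- have [y []] := filter_ex (filterI (xF m) (xF n)).
  rewrite -!ball_normE /= -!nrm_lt !mul1r => h1 h2.
  rewrite -(subrKA y); apply: le_trans (nrmD _ _) _.
  by rewrite lerD ?(ltW h1)// nrmBC ltW.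
apply/cvg_ex; exists l; apply/cvgrPdist_lt => e /gt0_ReE[e0 ->].
have [N eN] := @vanishing_delta R 4 (ler0n _ 4) _ e0.
apply: filterS (xF N) => y; rewrite -ball_normE /= -!nrm_lt => h1.
rewrite -(subrKA (x N)); apply: le_lt_trans (nrmD _ _) _.
have := lP N; rewrite nrmBC mul1r => h2; have := eN N (leqnn N).
have := delta_gt0 R N; lra.
Qed.

HB.instance Definition _ := Uniform_isComplete.Build K completion_complete.

Let cdot_norm f : cdot f f = `|f| ^+ 2.
Proof.
rewrite (ge0_ReE (cdot_ge0 f)) -(snorm_sqr cdot_semi_inner) rmorphXn.
by rewrite -completion_nrmE nrmE.
Qed.

HB.instance Definition _ :=
  isHilbert.Build R K cdotDr cdotZr cdotC cdot_norm.

End Completion.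

Lemma hilbert_completion (R : realType) (V : Type)
    (comb : R[i] -> V -> V -> V) (s : V -> V -> R[i]) (v0 : V) :
  semi_inner comb s ->
  exists (K : hilbertType R) (iota : V -> K),
    (forall v w, hdot (iota v) (iota w) = s v w) /\
    forall u (d : R), 0 < d -> exists v, nrm (u - iota v) <= d.
Proof.
move=> sP; exists (completion sP v0), (ciota sP v0).
split=> [v w|u d d0]; [exact: cdot_ciota|exact: completion_dense].
Qed.

(** * Bounded operators and inner products in Hilbert spaces *)

Lemma bounded_operatorP (R : realType) (U W : normedModType R[i]) (f : U -> W) :
  bounded_operator f <->
  linear f /\ exists2 M : R, 0 <= M & forall x, nrm (f x) <= M * nrm x.
Proof.
split=> [[fl [M fM]]|[fl [M M0 fM]]]; split=> //.
  (* On the zero space [M] is an arbitrary complex number, hence the maximum with 0. *)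
  exists (Num.max 0 (complex.Re M)) => [|x]; first by rewrite le_max lexx.
  have := fM x; rewrite !nrmE lecE => /andP[_ /=].
  rewrite mulrC Re_realM mulrC => /le_trans; apply.
  by rewrite ler_wpM2r ?nrm_ge0// le_max lexx orbT.
by exists M%:C%C => x; rewrite !nrmE -rmorphM lecR.
Qed.

Section LinearFun.
Variables (R : realType) (U W : lmodType R[i]) (f : U -> W).
Hypothesis fl : linear f.

Lemma lin0 : f 0 = 0.
Proof. by have := fl (-1) 0 0; rewrite scaler0 addr0 scaleN1r addNr. Qed.

Lemma linD x y : f (x + y) = f x + f y.
Proof. by have := fl 1 x y; rewrite !scale1r. Qed.

Lemma linZ k x : f (k *: x) = k *: f x.
Proof. by have := fl k x 0; rewrite !addr0 lin0 addr0. Qed.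

Lemma linN x : f (- x) = - f x.
Proof. by rewrite -scaleN1r linZ scaleN1r. Qed.

Lemma linB x y : f (x - y) = f x - f y.
Proof. by rewrite linD linN. Qed.

Lemma lin_sum I (r : seq I) (F : I -> U) :
  f (\sum_(i <- r) F i) = \sum_(i <- r) f (F i).
Proof. by elim/big_rec2: _ => [|i y x _ <-]; rewrite ?lin0// linD. Qed.

End LinearFun.

Section Hilbert.
Variables (R : realType) (H : hilbertType R).
Implicit Types x y z : H.

Lemma hdot_semi_inner : semi_inner (fun k x y => k *: x + y) (@hdot R H).
Proof.
split=> [x k y z|x y|x]; [by rewrite hdotDr hdotZr|exact: hdotC|].
by rewrite hdot_norm exprn_ge0.
Qed.

Lemma hdot_linear x : linear (fun y => hdot x y : R[i]^o).
Proof. by move=> k y z; rewrite hdotDr hdotZr. Qed.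

Lemma hdotxx x : hdot x x = (nrm x ^+ 2)%:C%C.
Proof. by rewrite hdot_norm nrmE rmorphXn. Qed.

Lemma Re_hdotxx x : complex.Re (hdot x x) = nrm x ^+ 2.
Proof. by rewrite hdotxx. Qed.

Lemma snorm_hdot x : snorm (@hdot R H) x = nrm x.
Proof. by rewrite /snorm Re_hdotxx sqrtr_sqr ger0_norm// nrm_ge0. Qed.

Lemma hdot_CS x y : nrm (hdot x y) <= nrm x * nrm y.
Proof. by rewrite -!snorm_hdot (si_CS hdot_semi_inner). Qed.

Lemma hdotNr x y : hdot x (- y) = - hdot x y.
Proof. exact: (linN (hdot_linear x)). Qed.

Lemma hdotBr x y z : hdot x (y - z) = hdot x y - hdot x z.
Proof. exact: (linB (hdot_linear x)). Qed.

Lemma hdot0r x : hdot x 0 = 0.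
Proof. exact: (lin0 (hdot_linear x)). Qed.

Lemma hdot_sumr I (r : seq I) x (F : I -> H) :
  hdot x (\sum_(i <- r) F i) = \sum_(i <- r) hdot x (F i).
Proof. exact: (lin_sum (hdot_linear x)). Qed.

Lemma hdotDl x y z : hdot (x + y) z = hdot x z + hdot y z.
Proof. by rewrite hdotC hdotDr conjD -!hdotC. Qed.

Lemma hdotZl k x y : hdot (k *: x) y = k^* * hdot x y.
Proof. by rewrite hdotC hdotZr conjM -hdotC. Qed.

Lemma hdotNl x y : hdot (- x) y = - hdot x y.
Proof. by rewrite hdotC hdotNr rmorphN /= -hdotC. Qed.

Lemma hdotBl x y z : hdot (x - y) z = hdot x z - hdot y z.
Proof. by rewrite hdotDl hdotNl. Qed.

Lemma hdot0l x : hdot 0 x = 0.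
Proof. by rewrite hdotC hdot0r conjC0. Qed.

Lemma hdot_suml I (r : seq I) x (F : I -> H) :
  hdot (\sum_(i <- r) F i) x = \sum_(i <- r) hdot (F i) x.
Proof. by elim/big_rec2: _ => [|i y z _ <-]; rewrite ?hdot0l// hdotDl. Qed.

Lemma hdot_eq0 x : hdot x x = 0 -> x = 0.
Proof.
by rewrite hdotxx => /complexI/eqP; rewrite sqrf_eq0 => /eqP/nrm_eq0.
Qed.

Lemma hdot_injr x y : (forall z, hdot z x = hdot z y) -> x = y.
Proof.
move=> xy; apply/eqP; rewrite -subr_eq0; apply/eqP/hdot_eq0.
by rewrite hdotBr xy subrr.
Qed.

Lemma hdot_injl x y : (forall z, hdot x z = hdot y z) -> x = y.
Proof. by move=> xy; apply: hdot_injr => z; rewrite hdotC xy -hdotC. Qed.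

End Hilbert.

(** * Riesz representation for finite families of maps *)

Section RieszFamily.
Variables (R : realType) (V : Type) (comb : R[i] -> V -> V -> V) (v0 : V).
Variables (K : hilbertType R) (n : nat) (iota : 'I_n -> V -> K).
Hypothesis iota_lin : forall j, comb_linear comb (iota j).

(** The inner product of K^n pulled back along v |-> (iota j v)_j, which spares the construction of
    K^n. *)
Definition family_dot v w : R[i] := \sum_j hdot (iota j v) (iota j w).

Lemma family_semi_inner : semi_inner comb family_dot.
Proof.
split=> [u k v w|v w|v].
- rewrite /family_dot mulr_sumr -big_split /=; apply: eq_bigr => j _.
  by rewrite iota_lin hdotDr hdotZr.
- rewrite /family_dot rmorph_sum; apply: eq_bigr => j _ /=.
  by rewrite -hdotC.
- by apply: sumr_ge0 => j _; rewrite hdot_norm exprn_ge0.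
Qed.

Lemma family_nrm_le j v : nrm (iota j v) <= snorm family_dot v.
Proof.
rewrite -ler_sqr ?nnegrE ?nrm_ge0 ?snorm_ge0// (snorm_sqr family_semi_inner).
rewrite /family_dot (bigD1 j)//= ReD Re_hdotxx lerDl.
by apply: ge0_Re; apply: sumr_ge0 => i _; rewrite hdot_norm exprn_ge0.
Qed.

(** The representative [p] lies in the closure of the image of [V] in K^n; when [phi] is the product
    with a tuple, [p] is thus the projection of that tuple on this closure. Approximate
    representatives are Cauchy because the square of their difference is a difference of defects. *)
Lemma Riesz_family (phi : V -> R[i]) (M : R) :
  (forall k v w, phi (comb k v w) = k * phi v + phi w) ->
  (forall v, nrm (phi v) <= M * snorm family_dot v) ->
  exists p : 'I_n -> K,
    (forall w, phi w = \sum_j hdot (p j) (iota j w)) /\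
    forall e : R, 0 < e -> exists v, forall j, nrm (p j - iota j v) <= e.
Proof.
move=> phi_lin phiM; have sP := family_semi_inner.
have /choice[x xP] m := approximate_Riesz sP phi_lin v0 phiM (delta_gt0 R m).
have dl := @vanishing_delta R 1 ler01.
have /choice[p pP] j : exists l, forall m, nrm (iota j (x m) - l) <= 1 * delta R m.
  apply: complete_limit => // m m'; rewrite !mul1r.
  set u := comb (- 1) (x m') (x m).
  have -> : iota j (x m) - iota j (x m') = iota j u.
    by rewrite iota_lin scaleN1r addrC.
  apply: le_trans (family_nrm_le _ _) _.
  have [|u0] := leP (snorm family_dot u) 0.
    by move=> u0; rewrite (le_trans u0)// addr_ge0// ltW// delta_gt0.
  rewrite -(ler_pM2r u0) -expr2 (snorm_sqr sP).
  apply: le_trans (Re_nrm _) _.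
  have -> : family_dot u u = (phi u - family_dot (x m') u) - (phi u - family_dot (x m) u).
    rewrite {1}/u (si_linl sP) rmorphN rmorph1; ring.
  by apply: le_trans (nrmD _ _) _; rewrite nrmN mulrDl addrC lerD.
exists p; split=> [w|e e0]; last first.
  have [N eN] := dl e e0; exists (x N) => j.
  by rewrite nrmBC (le_trans (pP _ _))// eN.
apply/eqP; rewrite -subr_eq0; apply/eqP/nrm_eq0/eqP; rewrite eq_le nrm_ge0 andbT.
apply: (@vanishing_le R (fun m => (snorm family_dot w + \sum_j nrm (iota j w)) * delta R m)).
  by apply: vanishing_delta; rewrite addr_ge0 ?snorm_ge0 ?sumr_ge0// => j _; exact: nrm_ge0.
move=> m; rewrite add0r -(subrKA (family_dot (x m) w)).
apply: le_trans (nrmD _ _) _; rewrite mulrDl lerD//; first by rewrite mulrC.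
rewrite /family_dot -sumrB mulr_suml.
apply: le_trans (nrm_sum _) _; apply: ler_sum => j _.
rewrite -hdotBl; apply: le_trans (hdot_CS _ _) _.
by rewrite mulrC ler_wpM2l ?nrm_ge0// (le_trans (pP _ _))// mul1r.
Qed.

End RieszFamily.

(** * Adjoints and extensions of bounded operators *)

Section Adjoints.
Variable R : realType.

Lemma hilbert_Riesz (K : hilbertType R) (phi : K -> R[i]) (M : R) :
  linear (phi : K -> R[i]^o) -> (forall x, nrm (phi x) <= M * nrm x) ->
  exists p, forall x, phi x = hdot p x.
Proof.
move=> phi_lin phiM.
have [||x|p [pP _]] := @Riesz_family R K (fun k x y => k *: x + y) 0 K 1
    (fun=> id) _ phi M.
- by [].
- exact: phi_lin.
- rewrite /snorm /family_dot big_ord1 Re_hdotxx sqrtr_sqr.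
  by rewrite ger0_norm ?nrm_ge0.
by exists (p ord0) => x; rewrite pP big_ord1.
Qed.

Lemma hilbert_adjoint (K L : hilbertType R) (f : K -> L) :
  bounded_operator f ->
  exists2 g : L -> K, bounded_operator g & forall x y, hdot (f x) y = hdot x (g y).
Proof.
move=> /bounded_operatorP[fl [M M0 fM]].
have /choice[g gP] y : exists p, forall x, hdot y (f x) = hdot p x.
  apply: (@hilbert_Riesz K _ (nrm y * M)) => [k u v|x].
    by rewrite fl hdotDr hdotZr.
  apply: le_trans (hdot_CS _ _) _.
  by rewrite -mulrA ler_wpM2l ?nrm_ge0.
exists g; last by move=> x y; rewrite hdotC gP -hdotC.
apply/bounded_operatorP; split=> [k u v|].
  by apply: hdot_injl => x; rewrite -gP !hdotDl !hdotZl !gP.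
exists M => // y; have := hdot_CS (g y) (g y).
have [->|] := eqVneq (nrm (g y)) 0; first by rewrite mulr_ge0 ?nrm_ge0.
move=> g0 _; have gp : 0 < nrm (g y) by rewrite lt_def g0 nrm_ge0.
rewrite -(ler_pM2r gp) -expr2 -Re_hdotxx -gP.
apply: le_trans (Re_nrm _) _; apply: le_trans (hdot_CS _ _) _.
by rewrite [M * _]mulrC -mulrA ler_wpM2l ?nrm_ge0.
Qed.

Section Dense.
Variables (V : Type) (K : hilbertType R) (iota : V -> K).
Hypothesis iota_dense : forall u (d : R), 0 < d -> exists v, nrm (u - iota v) <= d.

Lemma dense_orth (z : K) : (forall v, hdot z (iota v) = 0) -> z = 0.
Proof.
move=> z0; apply: nrm_eq0_small => e e0; have [v vP] := iota_dense z e0.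
have [->|] := eqVneq (nrm z) 0; first exact: ltW.
move=> zn; have zp : 0 < nrm z by rewrite lt_def zn nrm_ge0.
rewrite -(ler_pM2r zp) -expr2 -Re_hdotxx -[hdot z z]subr0 -(z0 v) -hdotBr.
apply: le_trans (Re_nrm _) _; apply: le_trans (hdot_CS _ _) _.
by rewrite mulrC ler_wpM2r ?nrm_ge0.
Qed.

Lemma dense_injl (x y : K) : (forall v, hdot x (iota v) = hdot y (iota v)) -> x = y.
Proof.
move=> xy; apply/eqP; rewrite -subr_eq0; apply/eqP/dense_orth => v.
by rewrite hdotBl xy subrr.
Qed.

Lemma dense_eq_operator (L : hilbertType R) (f g : K -> L) :
  bounded_operator f -> bounded_operator g ->
  (forall v, f (iota v) = g (iota v)) -> f =1 g.
Proof.
move=> /hilbert_adjoint[f' _ ff'] /hilbert_adjoint[g' _ gg'] fg x.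
apply: hdot_injl => y; rewrite ff' gg'; congr hdot.
apply: dense_injl => v; by rewrite hdotC -ff' fg gg' -hdotC.
Qed.

(** The extension is the adjoint of a map g, where g y is the Riesz representative of v |-> <y,
    omega v>. Well-definedness on the image of [iota] is thereby never at stake. *)
Lemma operator_extension (comb : R[i] -> V -> V -> V) (v0 : V)
    (L : hilbertType R) (omega : V -> L) (M : R) :
  comb_linear comb iota -> comb_linear comb omega -> 0 <= M ->
  (forall v, nrm (omega v) <= M * nrm (iota v)) ->
  exists2 f : K -> L, bounded_operator f & forall v, f (iota v) = omega v.
Proof.
move=> iota_lin omega_lin M0 omegaM.
have /choice[g gP] y : exists p, forall v, hdot y (omega v) = hdot p (iota v).
  have [|k v w|v|p [pP _]] := @Riesz_family R V comb v0 K 1 (fun=> iota) _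
      (fun v => hdot y (omega v)) (nrm y * M).
  - by move=> _.
  - by rewrite omega_lin hdotDr hdotZr.
  - rewrite /snorm /family_dot big_ord1 Re_hdotxx sqrtr_sqr ger0_norm ?nrm_ge0//.
    apply: le_trans (hdot_CS _ _) _.
    by rewrite -mulrA ler_wpM2l ?nrm_ge0.
  by exists (p ord0) => v; rewrite pP big_ord1.
have gl : linear g.
  move=> k u v; apply: dense_injl => w.
  by rewrite -gP !hdotDl !hdotZl !gP.
have /hilbert_adjoint[f fb fg] : bounded_operator g.
  apply/bounded_operatorP; split=> //; exists M => // y.
  have [->|] := eqVneq (nrm (g y)) 0; first by rewrite mulr_ge0 ?nrm_ge0.
  move=> g0; have gp : 0 < nrm (g y) by rewrite lt_def g0 nrm_ge0.
  rewrite -(ler_pM2r gp) -expr2.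
  apply: (@vanishing_le R (fun n => (M * nrm y + nrm (g y)) * delta R n)).
    by apply: vanishing_delta; rewrite addr_ge0 ?mulr_ge0 ?nrm_ge0.
  move=> n; have [v vP] := iota_dense (g y) (delta_gt0 R n).
  have h1 : complex.Re (hdot (g y) (g y - iota v)) <= nrm (g y) * delta R n.
    apply: le_trans (Re_nrm _) _; apply: le_trans (hdot_CS _ _) _.
    by rewrite ler_wpM2l ?nrm_ge0.
  have h2 : complex.Re (hdot (g y) (iota v)) <= nrm y * (M * (nrm (g y) + delta R n)).
    rewrite -gP; apply: le_trans (Re_nrm _) _; apply: le_trans (hdot_CS _ _) _.
    rewrite ler_wpM2l ?nrm_ge0// (le_trans (omegaM _))// ler_wpM2l//.
    rewrite -[iota v](subKr (g y)); apply: le_trans (nrmD _ _) _.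
    by rewrite nrmN lerD2l.
  rewrite -Re_hdotxx; move: h1; rewrite hdotBr ReB; lra.
exists f => // v; apply: hdot_injr => y.
by rewrite -fg -gP.
Qed.

End Dense.
End Adjoints.

(** * Strong approximation *)

Section Topology.
Local Open Scope classical_set_scope.
Variable R : realType.

Lemma denseP (K : normedModType R[i]) (S : set K) :
  dense S <-> forall u (d : R), 0 < d -> exists2 v, S v & nrm (u - v) <= d.
Proof.
split=> [dS u d d0|dS O [u Ou] oO].
  have [||v []] := dS (ball u d%:C%C).
  - by exists u; apply: ballxx; rewrite ltcR.
  - by apply: ball_open; rewrite ltcR.
  by rewrite -ball_normE /= -nrm_lt => h Sv; exists v => //; exact: ltW.
have /nbhs_ballP[e /= /gt0_ReE[e0 ->] eO] : nbhs u O by exact: open_nbhs_nbhs.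
have [v Sv uv] := dS u (complex.Re e / 2) (divr_gt0 e0 (ltr0n _ 2)).
exists v; split=> //; apply: eO; rewrite -ball_normE /= -nrm_lt; lra.
Qed.

Variables H K : hilbertType R.
Implicit Types (M : set (H -> K)) (f g : H -> K).

Definition strong_approx M f : Prop :=
  forall (r : seq H) (e : R), 0 < e ->
    exists2 g, M g & forall x, x \in r -> nrm (f x - g x) <= e.

Lemma ptws_near (F : set_system (H -> K)) f (r : seq H) (e : R) :
  Filter F -> {ptws, F --> f} -> 0 < e ->
  F [set g | forall x, x \in r -> nrm (f x - g x) <= e].
Proof.
move=> FF /pointwise_cvgP Ff e0; elim: r => [|y r IHr].
  by apply: filterE => g x; rewrite in_nil.
have yr : F [set g | nrm (f y - g y) <= e].
  have /cvgrPdist_lt/(_ e%:C%C) yr := Ff y.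
  have /yr : 0 < e%:C%C :> R[i] by rewrite ltcR.
  by apply: filterS => g /=; rewrite -nrm_lt => /ltW.
apply: filterS (filterI yr IHr) => g [gy gr] x.
by rewrite in_cons => /predU1P[->|/gr].
Qed.

Lemma ptws_closureP M f :
  closure (M : set {ptws H -> K}) f <-> strong_approx M f.
Proof.
split=> [clM r e e0|Mf].
  have ff : {ptws, nbhs (f : {ptws H -> K}) --> f} by [].
  have fr := ptws_near r (nbhs_filter (f : {ptws H -> K})) ff e0.
  by have [g [Mg gr]] := clM _ fr; exists g.
(* The filter generated by the traces on [M] of the basic neighbourhoods of [f]; its pointwise
   convergence to [f] is what the closure asks for. *)
pose F : set_system (H -> K) := [set B | exists (r : seq H) (e : R), 0 < e /\
  [set g | M g /\ forall x, x \in r -> nrm (f x - g x) <= e] `<=` B].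
have FF : ProperFilter F.
  apply: Build_ProperFilter_ex => [B [r [e [e0 rB]]]|].
    by have [g Mg gr] := Mf r e e0; exists g; apply: rB.
  split=> [|B C [r [e [e0 rB]]] [q [d [d0 qC]]]|B C BC [r [e [e0 rB]]]].
  - by exists [::], 1; split.
  - exists (r ++ q), (Num.min e d); split; first by rewrite lt_min e0.
    move=> g [Mg gP]; split; [apply: rB|apply: qC]; split=> // x xr.
      by have := gP x; rewrite mem_cat xr => /(_ isT)/le_trans; apply; rewrite ge_min lexx.
    by have := gP x; rewrite mem_cat xr orbT => /(_ isT)/le_trans; apply; rewrite ge_min lexx orbT.
  - by exists r, e; split=> //; exact: subset_trans BC.
have Ff : {ptws, F --> f}.
  apply/pointwise_cvgP => x; apply/cvgrPdist_lt => e /gt0_ReE[e0 ->].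
  exists [:: x], (complex.Re e / 2); split; first exact: divr_gt0.
  move=> g [_ /(_ x)]; rewrite mem_head => /(_ isT) h /=.
  rewrite -nrm_lt; lra.
move=> B /Ff [r [e [e0 rB]]].
by have [g Mg gr] := Mf r e e0; exists g; split=> //; apply: rB.
Qed.

Lemma strongly_closedP M : strongly_closed M <->
  forall f, bounded_operator f -> strong_approx M f -> M f.
Proof. by split=> MC f fb /ptws_closureP; apply: MC. Qed.

End Topology.

Section FormalSums.
Variables (R : realType) (X : Type) (W : lmodType R[i]).

Definition formal_comb (k : R[i]) (v w : seq (X * W)) : seq (X * W) :=
  [seq (p.1, k *: p.2) | p <- v] ++ w.

Definition formal_sum (U : lmodType R[i]) (F : X -> W -> U) (v : seq (X * W)) : U :=
  \sum_(p <- v) F p.1 p.2.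

Lemma formal_sum_linear (U : lmodType R[i]) (F : X -> W -> U) :
  (forall x, linear (F x)) -> comb_linear formal_comb (formal_sum F).
Proof.
move=> Fl k v w; rewrite /formal_sum big_cat big_map /= scaler_sumr.
by congr (_ + _); apply: eq_bigr => p _; rewrite (linZ (Fl _)).
Qed.

End FormalSums.

(** * Gram elements and strong density *)

Section VonNeumannAlgebra.
Variables (R : realType) (H : hilbertType R) (B : vnAlgType H).

Lemma vn_op_linear (b : B) : linear (vn_op b).
Proof. by have [] := vn_op_bounded b. Qed.

Lemma vn_op_linearl h : linear (fun b : B => vn_op b h).
Proof. by move=> k b c; rewrite vn_opD vn_opZ. Qed.

Lemma vn_op_inj (b c : B) : (forall h, vn_op b h = vn_op c h) -> b = c.
Proof.
move=> bc; apply/eqP; rewrite -subr_eq0 -normr_le0; apply: vn_op_norm_lub => // h.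
by rewrite (linB (vn_op_linearl h)) bc subrr normr0 mul0r.
Qed.

Lemma nrm_vn_op (b : B) h : nrm (vn_op b h) <= nrm b * nrm h.
Proof. by have := vn_op_norm_ub b h; rewrite !nrmE -rmorphM lecR. Qed.

Lemma vn_op_hdot_inj (b c : B) :
  (forall h k, hdot h (vn_op b k) = hdot h (vn_op c k)) -> b = c.
Proof. by move=> bc; apply: vn_op_inj => h; apply: hdot_injr => k; exact: bc. Qed.

Section Gram.
Variable K : hilbertType R.
Implicit Types f g : H -> K.

(** This is f^* g = [c], in weak form so that no adjoint has to be chosen. *)
Definition gram (c : B) f g : Prop :=
  forall h k, hdot (f h) (g k) = hdot h (vn_op c k).

Definition has_gram f g : Prop := exists c, gram c f g.

Lemma gram_sym c f g : gram c f g -> gram (star c) g f.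
Proof. by move=> cP h k; rewrite hdotC cP -hdotC vn_op_star. Qed.

Lemma gram_lin k c d f g1 g2 :
  gram c f g1 -> gram d f g2 -> gram (k *: c + d) f (fun h => k *: g1 h + g2 h).
Proof.
by move=> cP dP x y; rewrite vn_opD vn_opZ !hdotDr !hdotZr cP dP.
Qed.

Lemma gram_ract c b f g : gram c f g -> gram (c ** b) f (fun h => g (vn_op b h)).
Proof. by move=> cP h k; rewrite cP vn_opM. Qed.

Lemma gram_unique c d f g : gram c f g -> gram d f g -> c = d.
Proof. by move=> cP dP; apply: vn_op_hdot_inj => h k; rewrite -cP -dP. Qed.

Lemma gram0 f : gram 0 f (fun=> 0).
Proof. by move=> h k; rewrite (lin0 (vn_op_linearl _)) !hdot0r. Qed.

Lemma gram_sum (I : Type) (G : I -> H -> K) f (v : seq (I * B)) :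
  (forall i, has_gram f (G i)) ->
  has_gram f (fun h => formal_sum (fun i b => G i (vn_op b h)) v).
Proof.
move=> fG; elim: v => [|[i b] v [d dP]].
  by exists 0 => h k; rewrite /formal_sum big_nil; exact: (gram0 f).
have [c cP] := fG i; exists (1 *: (c ** b) + d) => h k.
rewrite /formal_sum big_cons /= -[G i _]scale1r.
exact: (gram_lin 1 (gram_ract b cP) dP).
Qed.

End Gram.

(* Let p be the projection of (f x)_(x in r) on the closure of the vectors
   (v x)_(x in r), with v a combination of the operators G i b. On r, the
   operator G i^* applied to f - p is a limit of values of G i^* (f - v), which
   lies in B; hence f - p is orthogonal to its own image under G i (G i)^*, and
   so it vanishes. *)
Lemma strong_density (K : hilbertType R) (I : Type) (G : I -> H -> K) (f : H -> K) :
  (forall i, bounded_operator (G i)) ->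
  (forall i j, has_gram (G i) (G j)) ->
  (forall z, (forall i h, hdot z (G i h) = 0) -> z = 0) ->
  (forall i, has_gram (G i) f) ->
  forall (r : seq H) (e : R), 0 < e -> exists v : seq (I * B),
    forall x, x \in r -> nrm (f x - formal_sum (fun i b => G i (vn_op b x)) v) <= e.
Proof.
move=> Gb GG Gtotal Gf r e e0.
pose ev x := formal_sum (fun i (b : B) => G i (vn_op b x)).
have ev_lin x : comb_linear (@formal_comb R I B) (ev x).
  apply: formal_sum_linear => i k b c; rewrite (vn_op_linearl x).
  by have [-> _] := Gb i.
pose h j := tnth (in_tuple r) j; pose iota j := ev (h j).
have iota_lin j : comb_linear (@formal_comb R I B) (iota j) by exact: ev_lin.
have [k v w|v|p [pP p_approx]] := @Riesz_family R _ (@formal_comb R I B) [::] K _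
    iota iota_lin (fun v => \sum_j hdot (f (h j)) (iota j v)) (\sum_j nrm (f (h j))).
- rewrite mulr_sumr -big_split; apply: eq_bigr => j _ /=.
  by rewrite iota_lin hdotDr hdotZr.
- rewrite mulr_suml; apply: le_trans (nrm_sum _) _; apply: ler_sum => j _.
  apply: le_trans (hdot_CS _ _) _; rewrite ler_wpM2l ?nrm_ge0//.
  exact: family_nrm_le.
pose zeta j := f (h j) - p j.
have zetaP w : \sum_j hdot (zeta j) (iota j w) = 0.
  rewrite (eq_bigr (fun j => hdot (f (h j)) (iota j w) - hdot (p j) (iota j w))).
    by rewrite sumrB pP subrr.
  by move=> j _; rewrite hdotBl.
suff zeta0 j : zeta j = 0.
  have [v vP] := p_approx e e0; exists v => x /(nthP 0)[j jr <-].
  have := vP (Ordinal jr); have := zeta0 (Ordinal jr).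
  rewrite /zeta => /eqP; rewrite subr_eq0 => /eqP <-.
  by rewrite /iota /h (tnth_nth 0).
apply: Gtotal => i x.
have [g /bounded_operatorP[gl [M M0 gM]] gP] := hilbert_adjoint (Gb i).
suff g0 : g (zeta j) = 0 by rewrite hdotC gP g0 hdot0r conjC0.
have approx (d : R) : 0 < d -> exists c : B,
    forall j, nrm (g (zeta j) - vn_op c (h j)) <= M * d.
  move=> d0; have [v vP] := p_approx d d0.
  have [c cP] := Gf i; have [c' c'P] := gram_sum v (GG i).
  exists (c - c') => l.
  have gE : g (f (h l)) = vn_op c (h l).
    by apply: hdot_injr => z; rewrite -gP cP.
  have gE' : g (iota l v) = vn_op c' (h l).
    by apply: hdot_injr => z; rewrite -gP c'P.
  rewrite (linB (vn_op_linearl _)) -gE -gE' -!(linB gl) /zeta opprB addrC subrKA.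
  by apply: le_trans (gM _) _; rewrite ler_wpM2l// nrmBC.
pose S := \sum_l nrm (g (zeta l)) ^+ 2.
suff S0 : S <= 0.
  apply: nrm_eq0; apply/eqP; rewrite -sqrf_eq0 eq_le sqr_ge0 andbT.
  apply: le_trans S0; rewrite /S (bigD1 j)//= lerDl.
  by apply: sumr_ge0 => l _; exact: sqr_ge0.
apply: (@vanishing_le R (fun n => (\sum_l nrm (g (zeta l)) * M) * delta R n)).
  by apply: vanishing_delta; rewrite sumr_ge0// => l _; rewrite mulr_ge0 ?nrm_ge0.
move=> n; rewrite add0r; have [c cP] := approx _ (delta_gt0 R n).
(* The one-term combination [G i c] is orthogonal to [zeta]; moving [G i] across gives sum_l <g
   (zeta l), c (h l)> = 0, so the squares below may be corrected by c (h l). *)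
have := zetaP [:: (i, c)].
under eq_bigr => l _ do rewrite /iota /ev /formal_sum big_seq1 /= hdotC gP -hdotC.
move=> orth.
have SE : S%:C%C = \sum_l hdot (g (zeta l)) (g (zeta l) - vn_op c (h l)).
  rewrite (eq_bigr (fun l => hdot (g (zeta l)) (g (zeta l))
                             - hdot (g (zeta l)) (vn_op c (h l)))).
    by rewrite sumrB orth subr0 rmorph_sum; apply: eq_bigr => l _; rewrite /= hdotxx.
  by move=> l _; rewrite hdotBr.
have -> : S = complex.Re S%:C%C by [].
rewrite SE; apply: le_trans (Re_nrm _) _; apply: le_trans (nrm_sum _) _.
rewrite mulr_suml; apply: ler_sum => l _; apply: le_trans (hdot_CS _ _) _.
by rewrite -mulrA ler_wpM2l ?nrm_ge0.
Qed.

End VonNeumannAlgebra.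

(** * Square roots in C*-algebras *)

Section CStarAlgebra.
Variables (R : realType) (A : cstarAlgType R).
Implicit Types a b c : A.

Lemma cmul_linearr a : linear (cmul a).
Proof. by move=> k b c; rewrite cmulDr cmulZr. Qed.

Lemma cmul_linearl b : linear (fun a => a ** b).
Proof. by move=> k a c; rewrite cmulDl cmulZl. Qed.

Lemma nrm_cmul a b : nrm (a ** b) <= nrm a * nrm b.
Proof. by have := cnormM a b; rewrite !nrmE -rmorphM lecR. Qed.

Lemma star0 : star (0 : A) = 0.
Proof. by have := starZ 0 (0 : A); rewrite conjC0 !scale0r. Qed.

Lemma starN a : star (- a) = - star a.
Proof. by rewrite -scaleN1r starZ rmorphN rmorph1 scaleN1r. Qed.

Lemma starB a b : star (a - b) = star a - star b.
Proof. by rewrite starD starN. Qed.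

Lemma star_cone : star (cone : A) = cone.
Proof. by have := starM (star cone) (cone : A); rewrite cmulr1 starK cmulr1. Qed.

Lemma nrm_star_cmul a : nrm (star a ** a) = nrm a ^+ 2.
Proof. by apply: complexI; rewrite -nrmE cstar_identity nrmE rmorphXn. Qed.

Lemma nrm_star a : nrm (star a) = nrm a.
Proof.
have le b : nrm b <= nrm (star b).
  have [->|b0] := eqVneq (nrm b) 0; first exact: nrm_ge0.
  have bp : 0 < nrm b by rewrite lt_def b0 nrm_ge0.
  by rewrite -(ler_pM2r bp) -expr2 -nrm_star_cmul nrm_cmul.
by apply/eqP; rewrite eq_le le andbT -{2}(starK a) le.
Qed.

Lemma cstar_pos_sa a : cstar_pos a -> star a = a.
Proof. by move=> [b ->]; rewrite starM starK. Qed.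

Section SquareRoot.
Variable x : A.
Hypotheses (x_sa : star x = x) (x1 : nrm x <= 1).

Let half : R[i] := (2^-1 : R)%:C%C.

Let nrm_half : nrm half = 2^-1.
Proof. by rewrite /half nrm_real ger0_norm// invr_ge0. Qed.

(* The iteration z |-> (x + z^2)/2, whose fixed points satisfy (1 - z)^2 = 1 - x,
   is dominated in norm, increments included, by the same iteration with x
   replaced by the scalar 1. *)
Fixpoint sqrt_iter n : A :=
  if n is m.+1 then half *: (x + sqrt_iter m ** sqrt_iter m) else 0.

Fixpoint sqrt_bound n : R :=
  if n is m.+1 then 2^-1 * (1 + sqrt_bound m ^+ 2) else 0.

Let r01 n : 0 <= sqrt_bound n <= 1.
Proof. by elim: n => [|n /andP[r0 r1]] /=; apply/andP; split; nra. Qed.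

Let r_mono m n : (m <= n)%N -> sqrt_bound m <= sqrt_bound n.
Proof.
elim: n m => [|n IHn] [|m]//; first by move=> _; have /andP[] := r01 n.+1.
rewrite ltnS => /IHn; have /andP[] := r01 m; have /andP[] := r01 n => /=; nra.
Qed.

Let nrm_z n : nrm (sqrt_iter n) <= sqrt_bound n.
Proof.
elim: n => [|n IHn] /=; first by rewrite nrm0.
rewrite nrmZ nrm_half ler_wpM2l ?invr_ge0//.
apply: le_trans (nrmD _ _) _; rewrite lerD//.
by apply: le_trans (nrm_cmul _ _) _; rewrite expr2 ler_pM ?nrm_ge0.
Qed.

(** The factorization z_n^2 - z_m^2 = (z_n - z_m) z_n + z_m (z_n - z_m) survives noncommutativity,
    and its norm is dominated by the scalar identity for r_n^2 - r_m^2. *)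
Let z_dist m n : (m <= n)%N ->
  nrm (sqrt_iter n - sqrt_iter m) <= sqrt_bound n - sqrt_bound m.
Proof.
elim: n m => [|n IHn] [|m] mn //.
- by rewrite !subrr nrm0.
- by rewrite [sqrt_iter 0]/= [sqrt_bound 0]/= !subr0; exact: nrm_z.
have /= -> : sqrt_iter n.+1 - sqrt_iter m.+1 =
  half *: ((sqrt_iter n - sqrt_iter m) ** sqrt_iter n
           + sqrt_iter m ** (sqrt_iter n - sqrt_iter m)).
  rewrite /= -scalerBr; congr (_ *: _).
  rewrite (linB (cmul_linearl _)) (linB (cmul_linearr _)) subrKA.
  by rewrite opprD addrACA subrr add0r.
rewrite nrmZ nrm_half.
have := IHn m mn; have := nrm_z n; have := nrm_z m.
have /andP[_ _] := r01 m; have /andP[_ _] := r01 n.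
have := r_mono mn.
have := nrmD ((sqrt_iter n - sqrt_iter m) ** sqrt_iter n)
             (sqrt_iter m ** (sqrt_iter n - sqrt_iter m)).
have := nrm_cmul (sqrt_iter n - sqrt_iter m) (sqrt_iter n).
have := nrm_cmul (sqrt_iter m) (sqrt_iter n - sqrt_iter m).
have := nrm_ge0 (sqrt_iter n - sqrt_iter m).
have := nrm_ge0 (sqrt_iter n); have := nrm_ge0 (sqrt_iter m).
move: (nrm _) => dn; nra.
Qed.

(** The scalar bounds increase below 1, so their distance to the supremum is a vanishing error for
    the iterates. The limit z is self-adjoint with 2z = x + z^2, and y = 1 - z. *)
Lemma one_minus_sqrt : exists2 y, star y = y & y ** y = cone - x.
Proof.
pose E := [set sqrt_bound n | n in [set: nat]]%classic.
have supE : has_sup E.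
  split; first by exists 0, 0%N.
  by exists 1 => _ [n _ <-]; have /andP[] := r01 n.
pose a n := sup E - sqrt_bound n.
have a_ge0 n : 0 <= a n.
  by rewrite subr_ge0; apply: ub_le_sup; [case: supE|exists n].
have a_vanish : vanishing a.
  move=> e e0; have [_ [N _ <-] NE] := sup_adherent e0 supE.
  by exists N => n /r_mono; rewrite /a; lra.
have [m n|z zP] := @complete_limit R A sqrt_iter a a_vanish.
  have [mn|/ltnW nm] := leqP m n.
    by rewrite nrmBC; apply: le_trans (z_dist mn) _; have := a_ge0 n; rewrite /a; lra.
  by apply: le_trans (z_dist nm) _; have := a_ge0 m; rewrite /a; lra.
have z_sa : star z = z.
  apply/eqP; rewrite -subr_eq0; apply/eqP/nrm_eq0_small => e e0.
  have [N aN] := a_vanish (e / 2) (divr_gt0 e0 (ltr0n _ 2)).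
  have iter_sa : star (sqrt_iter N) = sqrt_iter N.
    elim: N {aN} => [|N IHN] /=; first exact: star0.
    by rewrite starZ starD starM IHN x_sa conj_real.
  rewrite -(subrKA (sqrt_iter N)) -{1}iter_sa -starB.
  apply: le_trans (nrmD _ _) _; rewrite nrm_star nrmBC.
  by have := zP N; have := aN N (leqnn N); lra.
have z_fix : z = half *: (x + z ** z).
  apply/eqP; rewrite -subr_eq0; apply/eqP/nrm_eq0_small => e e0.
  (* The error is 1 from the next iterate plus (1 + |z|)/2 from the halved products, that is (3 +
     |z|)/2 times the error of one iterate. *)
  have e1 : 0 < e / (3 + nrm z) by rewrite divr_gt0// ltr_wpDr// nrm_ge0.
  have [N aN] := a_vanish _ e1.
  have aN1 := aN N (leqnn N); have aN2 := aN N.+1 (leqnSn N).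
  rewrite -(subrKA (sqrt_iter N.+1)) /= -scalerBr.
  have -> : x + sqrt_iter N ** sqrt_iter N - (x + z ** z) =
      (sqrt_iter N - z) ** sqrt_iter N + z ** (sqrt_iter N - z).
    rewrite (linB (cmul_linearl _)) (linB (cmul_linearr _)) subrKA.
    by rewrite opprD addrACA subrr add0r.
  apply: le_trans (nrmD _ _) _; rewrite nrmZ nrm_half.
  have := zP N.+1; rewrite nrmBC /= => h1; have h2 := zP N.
  have h3 := nrmD ((sqrt_iter N - z) ** sqrt_iter N) (z ** (sqrt_iter N - z)).
  have h4 := nrm_cmul (sqrt_iter N - z) (sqrt_iter N).
  have h5 := nrm_cmul z (sqrt_iter N - z).
  have h6 := nrm_ge0 z; have h7 := nrm_ge0 (sqrt_iter N - z).
  have h8 : nrm (sqrt_iter N) <= 1.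
    by apply: le_trans (nrm_z N) _; have /andP[] := r01 N.
  have h9 : nrm (sqrt_iter N - z) * nrm (sqrt_iter N) <= nrm (sqrt_iter N - z).
    by rewrite ler_piMr.
  have h10 : nrm z * nrm (sqrt_iter N - z) <= nrm z * (e / (3 + nrm z)).
    by rewrite ler_wpM2l// (le_trans h2).
  have h11 : e = (3 + nrm z) * (e / (3 + nrm z)).
    by rewrite mulrCA mulfV ?mulr1// gt_eqF// ltr_wpDr.
  have e2 := ltW e1; have h12 : 0 <= nrm z * (e / (3 + nrm z)) by rewrite mulr_ge0.
  set q := e / (3 + nrm z) in h10 h11 h12 e2 aN1 aN2 *.
  rewrite h11 mulrDl; lra.
exists (cone - z); first by rewrite starB star_cone z_sa.
rewrite (linB (cmul_linearl _)) cmul1 (linB (cmul_linearr _)) cmulr1.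
have -> : z ** z = z + z - x.
  rewrite {3 4}z_fix -scalerDl -rmorphD/=.
  have -> : (2^-1 + 2^-1 : R) = 1 by lra.
  by rewrite scale1r addrC addKr.
by rewrite opprB [z + z - x]addrAC addrK subrKA.
Qed.

End SquareRoot.
End CStarAlgebra.

(** * Norm and positivity of Gram elements *)

Section GramPositivity.
Variables (R : realType) (H : hilbertType R) (B : vnAlgType H) (K : hilbertType R).
Implicit Types (f : H -> K) (c : B).

Lemma vn_op_lub c (M : R) : 0 <= M ->
  (forall h, nrm (vn_op c h) <= M * nrm h) -> nrm c <= M.
Proof.
move=> M0 cM; rewrite nrm_le; apply: vn_op_norm_lub => [|h]; first by rewrite lecR.
by rewrite !nrmE -rmorphM lecR.
Qed.

Lemma gram_sqr c f h : gram c f f -> nrm (f h) ^+ 2 <= nrm c * nrm h ^+ 2.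
Proof.
move=> cP; rewrite -Re_hdotxx cP; apply: le_trans (Re_nrm _) _.
apply: le_trans (hdot_CS _ _) _; rewrite expr2 mulrCA ler_wpM2l ?nrm_ge0//.
exact: nrm_vn_op.
Qed.

Lemma gram_bound c f h : gram c f f -> nrm (f h) <= Num.sqrt (nrm c) * nrm h.
Proof.
move=> cP; rewrite -ler_sqr ?nnegrE ?mulr_ge0 ?sqrtr_ge0 ?nrm_ge0//.
by rewrite exprMn sqr_sqrtr ?nrm_ge0// gram_sqr.
Qed.

(** From |c h|^2 = <f (c h), f h> <= M |c h| M |h|. With [gram_bound], the square root of |c| is the
    operator norm of [f]. *)
Lemma gram_lub c f (M : R) : gram c f f -> 0 <= M ->
  (forall h, nrm (f h) <= M * nrm h) -> Num.sqrt (nrm c) <= M.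
Proof.
move=> cP M0 fM; rewrite -ler_sqr ?nnegrE ?sqrtr_ge0// sqr_sqrtr ?nrm_ge0//.
apply: vn_op_lub => [|h]; first exact: sqr_ge0.
have [->|] := eqVneq (nrm (vn_op c h)) 0; first by rewrite mulr_ge0 ?nrm_ge0 ?sqr_ge0.
move=> ch0; have chp : 0 < nrm (vn_op c h) by rewrite lt_def ch0 nrm_ge0.
rewrite -(ler_pM2r chp) -expr2 -Re_hdotxx -cP.
apply: le_trans (Re_nrm _) _; apply: le_trans (hdot_CS _ _) _.
rewrite (_ : M ^+ 2 * _ * _ = (M * nrm (vn_op c h)) * (M * nrm h)); last by ring.
by rewrite ler_pM ?nrm_ge0.
Qed.

(** With t = |c|, the element x = 1 - c/t is a self-adjoint contraction, so c/t = 1 - x has a square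
    root y in B and c is the square of sqrt(t) y. *)
Lemma gram_pos c f : gram c f f -> cstar_pos c.
Proof.
move=> cP; have c_sa : star c = c by exact: gram_unique (gram_sym cP) cP.
have [c0|] := eqVneq (nrm c) 0.
  by exists 0; rewrite (nrm_eq0 c0) (lin0 (cmul_linearr _)).
set t := nrm c => t0; have tp : 0 < t by rewrite lt_def t0 nrm_ge0.
(* This is c^2 <= t c; it gives |x h|^2 <= |h|^2 - |f h|^2 / t below. *)
have ch_le h : nrm (vn_op c h) ^+ 2 <= t * nrm (f h) ^+ 2.
  have [->|] := eqVneq (nrm (vn_op c h)) 0.
    by rewrite expr0n mulr_ge0 ?sqr_ge0 ?(ltW tp).
  move=> ch0; have chp : 0 < nrm (vn_op c h) by rewrite lt_def ch0 nrm_ge0.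
  have h1 : nrm (vn_op c h) ^+ 2 <= Num.sqrt t * nrm (vn_op c h) * nrm (f h).
    rewrite -Re_hdotxx -cP; apply: le_trans (Re_nrm _) _.
    apply: le_trans (hdot_CS _ _) _; rewrite ler_wpM2r ?nrm_ge0//.
    exact: gram_bound.
  have h2 : nrm (vn_op c h) <= Num.sqrt t * nrm (f h).
    by rewrite -(ler_pM2r chp) -expr2 mulrAC.
  rewrite -[t in leRHS]sqr_sqrtr ?(ltW tp)// -exprMn.
  by rewrite ler_sqr ?nnegrE ?mulr_ge0 ?sqrtr_ge0 ?nrm_ge0.
pose k : R[i] := t^-1%:C%C; pose x := cone - k *: c.
have x_sa : star x = x by rewrite starB star_cone starZ c_sa conj_real.
have x1 : nrm x <= 1.
  apply: vn_op_lub => // h; rewrite mul1r -ler_sqr ?nnegrE ?nrm_ge0//.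
  rewrite /x (linB (vn_op_linearl h)) vn_op1 vn_opZ -!Re_hdotxx.
  rewrite hdotBl !hdotBr !hdotZl !hdotZr conj_real !ReB !Re_realM.
  have -> : complex.Re (hdot (vn_op c h) h) = nrm (f h) ^+ 2.
    by rewrite hdotC cRe_conj -cP Re_hdotxx.
  rewrite -cP !Re_hdotxx; have := ch_le h; set u := nrm (vn_op c h) ^+ 2.
  set v := nrm (f h) ^+ 2 => uv.
  have v0 : 0 <= v by exact: sqr_ge0.
  have : t^-1 * u <= v by rewrite mulrC ler_pdivrMr// mulrC.
  have : 0 < t^-1 by rewrite invr_gt0.
  nra.
have [y y_sa yy] := one_minus_sqrt x_sa x1.
exists ((Num.sqrt t)%:C%C *: y).
rewrite starZ conj_real y_sa (linZ (cmul_linearr _)) (linZ (cmul_linearl _)) yy.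
rewrite /x subKr !scalerA -!rmorphM/= -expr2 sqr_sqrtr ?(ltW tp)//.
by rewrite mulfV ?scale1r.
Qed.

End GramPositivity.

(** * Modules of operators *)

Section OperatorModule.
Variables (R : realType) (H : hilbertType R) (B : vnAlgType H) (K : hilbertType R).

(** Closure properties under which [P] becomes a pre-Hilbert B-module for <f, g> = f^* g. *)
Record operator_module (P : set (H -> K)) : Prop := OperatorModule {
  om_linear : forall f, P f -> linear f ;
  om_zero : P (fun=> 0) ;
  om_lin : forall k f g, P f -> P g -> P (fun h => k *: f h + g h) ;
  om_ract : forall f (b : B), P f -> P (fun h => f (vn_op b h)) ;
  om_gram : forall f g, P f -> P g -> has_gram B f g
}.

Definition operator_pred (P : set (H -> K)) : {pred H -> K} := fun f => `[< P f >].

Record opmod (P : set (H -> K)) (PP : operator_module P) := OpMod {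
  opfun :> H -> K ;
  opfun_in : opfun \in operator_pred P }.

Variables (P : set (H -> K)) (PP : operator_module P).
Local Notation F := (opmod PP).

HB.instance Definition _ := [isSub of F for @opfun P PP].
HB.instance Definition _ := [Choice of F by <:].

Lemma opfunP (f : F) : P f.
Proof. by apply/asboolP; exact: opfun_in. Qed.

Lemma mem_operator_pred (f : H -> K) : P f -> f \in operator_pred P.
Proof. by move=> Pf; apply/asboolP. Qed.

Definition opmod_of (f : H -> K) (Pf : P f) : F := OpMod PP (mem_operator_pred Pf).

Lemma opfun_inj (f g : F) : (forall h, f h = g h) -> f = g.
Proof. by move=> fg; apply: val_inj; apply/funext => h; exact: fg. Qed.

End OperatorModule.

Section OperatorModuleLinear.
Variables (R : realType) (H : hilbertType R) (B : vnAlgType H) (K : hilbertType R).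
Variables (P : set (H -> K)) (PP : operator_module B P).
Local Notation F := (opmod PP).

Lemma operator_pred_submod : submod_closed (operator_pred P).
Proof.
split=> [|k f g /asboolP Pf /asboolP Pg]; apply/asboolP; first exact: om_zero PP.
exact: (om_lin PP).
Qed.

HB.instance Definition _ :=
  GRing.SubChoice_isSubLmodule.Build R[i] (H -> K) (operator_pred P) F
    operator_pred_submod.

Lemma opfunD (f g : F) h : (f + g) h = f h + g h.
Proof. by []. Qed.

Lemma opfunZ k (f : F) h : (k *: f) h = k *: f h.
Proof. by []. Qed.

Definition op_inner (f g : F) : B := projT1 (cid (om_gram PP (opfunP f) (opfunP g))).

Lemma op_innerP (f g : F) : gram (op_inner f g) f g.
Proof. exact: (projT2 (cid (om_gram PP (opfunP f) (opfunP g)))). Qed.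

Definition op_ract (f : F) (b : B) : F := opmod_of PP (om_ract PP b (opfunP f)).

Definition op_norm (f : F) : R := Num.sqrt (nrm (op_inner f f)).

Let op_normD f g : (op_norm (f + g))%:C%C <= (op_norm f)%:C%C + (op_norm g)%:C%C :> R[i].
Proof.
rewrite -rmorphD lecR; apply: (gram_lub (op_innerP (f + g) (f + g))).
  by rewrite addr_ge0 ?sqrtr_ge0.
move=> h; rewrite opfunD mulrDl; apply: le_trans (nrmD _ _) _.
by rewrite lerD ?(gram_bound _ (op_innerP _ _)).
Qed.

Let op_normZ (k : R[i]) f : (op_norm (k *: f))%:C%C = `|k| * (op_norm f)%:C%C :> R[i].
Proof.
have -> : `|k| * (op_norm f)%:C%C = (nrm k * op_norm f)%:C%C by rewrite rmorphM nrmE.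
congr (_%:C)%C; rewrite /op_norm.
have -> : op_inner (k *: f) (k *: f) = (k^* * k) *: op_inner f f.
  apply: (gram_unique (op_innerP _ _)) => x y.
  by rewrite opfunZ opfunZ hdotZl hdotZr op_innerP vn_opZ hdotZr mulrA.
rewrite nrmZ nrmM nrm_conj -expr2 sqrtrM ?sqr_ge0// sqrtr_sqr.
by rewrite ger0_norm// nrm_ge0.
Qed.

Let op_norm_eq0 f : (op_norm f)%:C%C = 0 :> R[i] -> f = 0.
Proof.
move=> /complexI f0; apply: opfun_inj => h; apply: nrm_eq0; apply/eqP.
rewrite eq_le nrm_ge0 andbT; have := gram_bound h (op_innerP f f).
by rewrite -/(op_norm f) f0 mul0r.
Qed.

HB.instance Definition _ :=
  Lmodule_isNormed.Build R[i] F op_normD op_normZ op_norm_eq0.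

Let op_ractDl f g b : op_ract (f + g) b = op_ract f b + op_ract g b.
Proof. exact: opfun_inj. Qed.

Let op_ractDr f b c : op_ract f (b + c) = op_ract f b + op_ract f c.
Proof.
apply: opfun_inj => h; rewrite opfunD /= vn_opD.
exact: (linD (om_linear PP (opfunP f))).
Qed.

Let op_ractZl k f b : op_ract (k *: f) b = k *: op_ract f b.
Proof. exact: opfun_inj. Qed.

Let op_ractZr k f b : op_ract f (k *: b) = k *: op_ract f b.
Proof.
apply: opfun_inj => h; rewrite opfunZ /= vn_opZ.
exact: (linZ (om_linear PP (opfunP f))).
Qed.

Let op_ractM f b c : op_ract f (b ** c) = op_ract (op_ract f b) c.
Proof. by apply: opfun_inj => h /=; rewrite vn_opM. Qed.

Let op_ract1 f : op_ract f cone = f.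
Proof. by apply: opfun_inj => h /=; rewrite vn_op1. Qed.

Let op_innerDr f g h : op_inner f (g + h) = op_inner f g + op_inner f h.
Proof.
apply: (gram_unique (op_innerP _ _)) => x y.
by rewrite opfunD hdotDr vn_opD hdotDr !op_innerP.
Qed.

Let op_innerZr k f g : op_inner f (k *: g) = k *: op_inner f g.
Proof.
apply: (gram_unique (op_innerP _ _)) => x y.
by rewrite opfunZ hdotZr vn_opZ hdotZr op_innerP.
Qed.

Let op_inner_ract f g b : op_inner f (op_ract g b) = op_inner f g ** b.
Proof. exact: gram_unique (op_innerP f (op_ract g b)) (gram_ract b (op_innerP f g)). Qed.

Let op_innerC f g : op_inner g f = star (op_inner f g).
Proof. exact: gram_unique (op_innerP _ _) (gram_sym (op_innerP f g)). Qed.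

Let op_inner_ge0 f : cstar_pos (op_inner f f).
Proof. exact: gram_pos (op_innerP f f). Qed.

Let op_inner_norm (f : F) : `|op_inner f f| = `|f| ^+ 2.
Proof.
rewrite nrmE (_ : `|f| = (op_norm f)%:C%C)// -rmorphXn.
by rewrite sqr_sqrtr// nrm_ge0.
Qed.

HB.instance Definition _ := isPreHilbertModule.Build R B F
  op_ractDl op_ractDr op_ractZl op_ractZr op_ractM op_ract1
  op_innerDr op_innerZr op_inner_ract op_innerC op_inner_ge0 op_inner_norm.

Lemma opmod_interior_tensor :
  (forall u (d : R), 0 < d -> exists n (x : 'I_n -> F) (h : 'I_n -> H),
     nrm (u - \sum_(i < n) x i (h i)) <= d) ->
  interior_tensor (fun (f : F) h => f h).
Proof.
move=> F_dense; split.
- by [].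
- by move=> f h k; exact: (linD (om_linear PP (opfunP f))).
- by [].
- by move=> k f h; exact: (linZ (om_linear PP (opfunP f))).
- by [].
- by move=> f g h k; rewrite op_innerP.
- apply/denseP => u d /(F_dense u)[n [x [h uP]]].
  by exists (\sum_(i < n) x i (h i)) => //; exists n, x, h.
Qed.

End OperatorModuleLinear.

Lemma von_neumann_operator_module (R : realType) (H : hilbertType R)
    (B : vnAlgType H) (K : hilbertType R) (P : set (H -> K)) :
  operator_module B P ->
  (forall u (d : R), 0 < d -> exists n (x : 'I_n -> H -> K) (h : 'I_n -> H),
     (forall i, P (x i)) /\ nrm (u - \sum_(i < n) x i (h i)) <= d) ->
  exists (F : preHilbertModType B) (t : F -> H -> K),
    interior_tensor t /\ range t = P.
Proof.
move=> PP P_dense; exists (opmod PP), (fun (f : opmod PP) h => f h); split.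
  apply: opmod_interior_tensor => u d /(P_dense u)[n [x [h [Px uP]]]].
  by exists n, (fun i => opmod_of PP (Px i)), h.
rewrite eqEsubset; split=> [_ [f _ <-]|f Pf]; first exact: opfunP.
by exists (opmod_of PP Pf).
Qed.

(** * Positivity of the form attached to a completely positive map *)

Lemma ge0_approx (R : realType) (z : R[i]) :
  (forall e : R, 0 < e -> exists2 w, 0 <= w & nrm (z - w) <= e) -> 0 <= z.
Proof.
case: z => x y zP; rewrite lecE /=.
have [x0 y0] : (forall e, 0 < e -> 0 <= x + e) /\ (forall e, 0 < e -> `|y| <= e).
  split=> e /zP[[u v]]; rewrite lecE /= => /andP[/eqP v0 u0] h.
    have := le_trans (normRe_nrm _) h; rewrite ler_norml /= => /andP[]; lra.
  by have := le_trans (normIm_nrm _) h; rewrite ImB /= v0 subr0.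
apply/andP; split.
  by rewrite -normr_eq0 eq_le normr_ge0 andbT; apply/ler_addgt0Pr => e /y0; rewrite add0r.
by apply/ler_addgt0Pr.
Qed.

Section MatrixPositivity.
Variables (R : realType) (H : hilbertType R) (B : vnAlgType H).

(** The projection of [x] on the closure of B eta. The last two clauses drive the induction in
    [matrix_pos]; treating x = 0 and x = eta beforehand avoids an argument on uniqueness of the
    projection. *)
Lemma cyclic_decomposition (eta x : H) : exists p,
  [/\ forall b : B, hdot (x - p) (vn_op b eta) = 0,
      forall e : R, 0 < e -> exists b : B, nrm (p - vn_op b eta) <= e,
      x = 0 -> p = 0 & x = eta -> p = eta].
Proof.
have [->|x0] := eqVneq x 0.
  exists 0; split=> // [b|e e0]; first by rewrite subrr hdot0l.
  by exists 0; rewrite (lin0 (vn_op_linearl _)) subrr nrm0 ltW.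
have [->|xeta] := eqVneq x eta.
  exists eta; split=> // [b|e e0]; first by rewrite subrr hdot0l.
  by exists cone; rewrite vn_op1 subrr nrm0 ltW.
have [j k b c|k b c|b|p [pP p_approx]] := @Riesz_family R B
    (fun k b c => k *: b + c) 0 H 1 (fun _ b => vn_op b eta) _
    (fun b => hdot x (vn_op b eta)) (nrm x).
- exact: vn_op_linearl.
- by rewrite vn_opD vn_opZ hdotDr hdotZr.
- apply: le_trans (hdot_CS _ _) _; rewrite ler_wpM2l ?nrm_ge0//.
  by rewrite /snorm /family_dot big_ord1 Re_hdotxx sqrtr_sqr ger0_norm ?nrm_ge0.
exists (p ord0); split=> [b|e /p_approx[b bP]|xE|xE].
- by rewrite hdotBl pP big_ord1 subrr.
- by exists b.
- by rewrite xE eqxx in x0.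
- by rewrite xE eqxx in xeta.
Qed.

Variables (n : nat) (t : 'I_n -> 'I_n -> B).
Hypothesis t_pos : forall b : 'I_n -> B,
  cstar_pos (\sum_(i < n) \sum_(j < n) star (b j) ** t j i ** b i).

Let Q (h : 'I_n -> H) := \sum_i \sum_j hdot (h j) (vn_op (t j i) (h i)).

(** At tuples b_i eta with a common eta, [Q] is <eta, c eta> for c = sum b_j^* t_ji b_i, which
    [t_pos] makes nonnegative. The limits of such tuples follow by continuity of [Q]. *)
Let Q_cyclic (eta : H) (p : 'I_n -> H) :
  (forall i (e : R), 0 < e -> exists b : B, nrm (p i - vn_op b eta) <= e) -> 0 <= Q p.
Proof.
move=> p_approx; apply: ge0_approx => e e0.
pose S := \sum_i \sum_j nrm (t j i) * (nrm (p j) + nrm (p i) + 1).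
have S0 : 0 <= S.
  by apply: sumr_ge0 => i _; apply: sumr_ge0 => j _; rewrite mulr_ge0 ?addr_ge0 ?nrm_ge0.
have S1 : 0 < S + 1 by rewrite ltr_wpDl.
pose d := Num.min 1 (e / (S + 1)).
have d0 : 0 < d by rewrite lt_min ltr01 divr_gt0.
have d1 : d <= 1 by rewrite ge_min lexx.
have dS : S * d <= e.
  have : d * (S + 1) <= e by rewrite -ler_pdivlMr// ge_min lexx orbT.
  by nra.
have /choice[b bP] i := p_approx i d d0.
exists (Q (fun i => vn_op (b i) eta)).
  have [c cP] := t_pos b.
  suff -> : Q (fun i => vn_op (b i) eta) = hdot (vn_op c eta) (vn_op c eta).
    by rewrite hdot_norm exprn_ge0.
  rewrite vn_op_star -vn_opM -cP /Q.
  rewrite (lin_sum (vn_op_linearl _)) hdot_sumr; apply: eq_bigr => i _.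
  rewrite (lin_sum (vn_op_linearl _)) hdot_sumr; apply: eq_bigr => j _.
  by rewrite vn_op_star -!vn_opM.
rewrite /Q -sumrB; apply: le_trans (nrm_sum _) _.
apply: le_trans dS; rewrite /S mulr_suml; apply: ler_sum => i _.
rewrite -sumrB mulr_suml; apply: le_trans (nrm_sum _) _; apply: ler_sum => j _.
set q := fun i => vn_op (b i) eta.
have qP l : nrm (p l - q l) <= d by exact: bP.
rewrite -(subrKA (hdot (p j) (vn_op (t j i) (q i)))).
rewrite -hdotBr -(linB (vn_op_linear _)) -hdotBl.
apply: le_trans (nrmD _ _) _.
have h1 : nrm (hdot (p j) (vn_op (t j i) (p i - q i))) <= nrm (p j) * (nrm (t j i) * d).
  apply: le_trans (hdot_CS _ _) _; rewrite ler_wpM2l ?nrm_ge0//.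
  by apply: le_trans (nrm_vn_op _ _) _; rewrite ler_wpM2l ?nrm_ge0.
have h2 : nrm (hdot (p j - q j) (vn_op (t j i) (q i))) <= d * (nrm (t j i) * (nrm (p i) + 1)).
  apply: le_trans (hdot_CS _ _) _; rewrite ler_pM ?nrm_ge0//.
  apply: le_trans (nrm_vn_op _ _) _; rewrite ler_wpM2l ?nrm_ge0//.
  rewrite -[q i](subKr (p i)); apply: le_trans (nrmD _ _) _.
  by rewrite nrmN lerD2l (le_trans (qP i)).
apply: le_trans (lerD h1 h2) _; lra.
Qed.

(** The closure of B eta is invariant under B, so it contains b p. *)
Let cross (eta p r : H) (b : B) :
  (forall c : B, hdot r (vn_op c eta) = 0) ->
  (forall e : R, 0 < e -> exists c : B, nrm (p - vn_op c eta) <= e) ->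
  hdot r (vn_op b p) = 0.
Proof.
move=> r_orth p_approx; apply/nrm_eq0/eqP; rewrite eq_le nrm_ge0 andbT.
apply: (@vanishing_le R (fun n => nrm r * nrm b * delta R n)).
  by apply: vanishing_delta; rewrite mulr_ge0 ?nrm_ge0.
move=> m; rewrite add0r; have [c cP] := p_approx _ (delta_gt0 R m).
rewrite -(subr0 (hdot r _)) -(r_orth (b ** c)) vn_opM -hdotBr -(linB (vn_op_linear _)).
apply: le_trans (hdot_CS _ _) _; rewrite -mulrA ler_wpM2l ?nrm_ge0//.
by apply: le_trans (nrm_vn_op _ _) _; rewrite ler_wpM2l ?nrm_ge0.
Qed.

(* By induction on the number of nonzero entries of h: splitting off the cyclic
   subspace generated by a nonzero h i kills that entry and creates no new
   nonzero entry. *)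
Lemma matrix_pos (h : 'I_n -> H) : 0 <= Q h.
Proof.
have [m] := ubnP #|[pred i | h i != 0]|.
elim: m h => // m IHm h hm.
have [i0 hi0|h0] := pickP (fun i => h i != 0); last first.
  rewrite /Q big1// => i _; rewrite big1// => j _.
  by have /eqP -> := negbFE (h0 j); rewrite hdot0l.
have /choice[p pP] i := cyclic_decomposition (h i0) (h i).
have p_orth i : forall b : B, hdot (h i - p i) (vn_op b (h i0)) = 0 by case: (pP i).
have p_approx i : forall e : R, 0 < e -> exists b : B, nrm (p i - vn_op b (h i0)) <= e.
  by case: (pP i).
pose r i := h i - p i.
(* Both kinds of mixed terms vanish by [cross], one of them after moving t_ji to the other side. *)
have -> : Q h = Q p + Q r.
  rewrite /Q -big_split; apply: eq_bigr => i _ /=; rewrite -big_split.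
  apply: eq_bigr => j _ /=.
  rewrite -{1}[h j](subrK (p j)) -{1}[h i](subrK (p i)) -/(r i) -/(r j).
  rewrite (linD (vn_op_linear _)) hdotDl !hdotDr.
  rewrite (cross (t j i) (p_orth j) (p_approx i)) addr0.
  suff -> : hdot (p j) (vn_op (t j i) (r i)) = 0 by rewrite add0r addrC.
  rewrite -{1}[t j i]starK -vn_op_star hdotC.
  by rewrite (cross _ (p_orth i) (p_approx j)) conjC0.
apply: addr_ge0; first exact: Q_cyclic p_approx.
apply: IHm; rewrite -ltnS; apply: leq_trans hm.
rewrite ltnS; apply: proper_card; apply/properP; split.
  apply/fintype.subsetP => i; rewrite !inE; apply: contra_neq => hi.
  by rewrite /r; have [_ _ /(_ hi) -> _] := pP i; rewrite hi subrr.
exists i0; rewrite !inE//; have [_ _ _ /(_ erefl) pi0] := pP i0.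
by rewrite /r pi0 subrr eqxx.
Qed.

End MatrixPositivity.

Section CompletelyPositive.
Variables (R : realType) (A : cstarAlgType R) (H : hilbertType R) (B : vnAlgType H).
Variable tau : {linear A -> B}.
Hypothesis tau_cp : completely_positive tau.

(** Positivity makes tau(c^* c) self-adjoint. Expanding at 1 + c shows that tau preserves
    self-adjointness of c + c^*, and the cases c = a and c = i a together isolate tau at the adjoint
    of a. *)
Lemma cp_star a : tau (star a) = star (tau a).
Proof.
have sa c : star (tau (star c ** c)) = tau (star c ** c).
  apply: cstar_pos_sa; have := tau_cp (fun _ : 'I_1 => c) (fun=> cone).
  by rewrite !big_ord1 star_cone cmul1 cmulr1.
have sa2 c : star (tau c) + star (tau (star c)) = tau c + tau (star c).
  have := sa (cone + c).
  rewrite starD star_cone cmulDl !cmulDr cmul1 cmulr1 !cmul1 !linearD /= !starD.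
  have := sa cone; rewrite star_cone cmul1 => ->; rewrite sa.
  by rewrite -!addrA => /addrI; rewrite !addrA => /addIr.
have i0 : ('i%C : R[i]) != 0 by rewrite complexiE neq0Ci.
have h1 : star (tau (star a)) - star (tau a) = tau a - tau (star a).
  apply: (scalerI i0); have := sa2 ('i%C *: a).
  rewrite starZ !linearZ /= !starZ conjCK complexiE conjCi.
  by rewrite !scaleNr [- _ + _]addrC !scalerBr.
have h2 : 2 *: star (tau (star a)) = 2 *: tau a.
  rewrite !scaler_nat !mulr2n; have := congr2 +%R h1 (sa2 a).
  by rewrite subrKA addrACA addNr addr0.
by rewrite -(scalerI _ h2) ?starK// pnatr_eq0.
Qed.

End CompletelyPositive.

(** * Stinespring dilation *)

(** Preserving inner products forces linearity: the defect is orthogonal to every [iota u], hence to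
    itself. *)
Lemma iota_comb_linear (R : realType) (V : Type) (comb : R[i] -> V -> V -> V)
    (s : V -> V -> R[i]) (K : hilbertType R) (iota : V -> K) :
  semi_inner comb s -> (forall v w, hdot (iota v) (iota w) = s v w) ->
  comb_linear comb iota.
Proof.
move=> sP iotaP k v w; apply/eqP; rewrite -subr_eq0; apply/eqP/hdot_eq0.
set x := iota (comb k v w) - _.
have x0 u : hdot (iota u) x = 0.
  by rewrite hdotBr hdotDr hdotZr !iotaP (si_lin sP) subrr.
by rewrite {1}/x hdotBl hdotDl hdotZl !x0 mulr0 addr0 subrr.
Qed.

Lemma bounded_operator_comp (R : realType) (U W Z : normedModType R[i])
    (f : U -> W) (g : W -> Z) :
  bounded_operator f -> bounded_operator g -> bounded_operator (fun x => g (f x)).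
Proof.
move=> /bounded_operatorP[fl [M M0 fM]] /bounded_operatorP[gl [N N0 gN]].
apply/bounded_operatorP; split=> [k x y|]; first by rewrite fl gl.
exists (N * M) => [|x]; first exact: mulr_ge0.
by apply: le_trans (gN _) _; rewrite -mulrA ler_wpM2l.
Qed.

Section Dilation.
Variables (R : realType) (A : cstarAlgType R) (H : hilbertType R) (B : vnAlgType H).
Variable tau : {linear A -> B}.

(* g a h is the vector a (x) h of the Stinespring space K. *)
Record dilation (K : hilbertType R) (g : A -> H -> K) : Prop := Dilation {
  dil_bounded : forall a, bounded_operator (g a) ;
  dil_gram : forall a b, gram (tau (star a ** b)) (g a) (g b) ;
  dil_dense : forall u (d : R), 0 < d ->
    exists v : seq (A * H), nrm (u - formal_sum g v) <= d
}.

Lemma dilation_exists : completely_positive tau ->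
  exists (K : hilbertType R) (g : A -> H -> K), dilation g.
Proof.
move=> tau_cp.
pose s (v w : seq (A * H)) : R[i] := \sum_(p <- v) \sum_(q <- w)
  hdot p.2 (vn_op (tau (star p.1 ** q.1)) q.2).
have sP : semi_inner (@formal_comb R A H) s.
  split=> [u k v w|v w|v].
  - rewrite /s mulr_sumr -big_split; apply: eq_bigr => p _ /=.
    rewrite big_cat big_map mulr_sumr /=; congr (_ + _).
    by apply: eq_bigr => q _; rewrite (linZ (vn_op_linear _)) hdotZr.
  - rewrite /s rmorph_sum exchange_big; apply: eq_bigr => p _ /=.
    rewrite rmorph_sum; apply: eq_bigr => q _ /=.
    by rewrite -hdotC vn_op_star -(cp_star tau_cp) starM starK.
  - rewrite /s exchange_big /= big_tnth.
    under eq_bigr do rewrite big_tnth.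
    exact: (@matrix_pos R H B _ (fun j i => tau
      (star (tnth (in_tuple v) j).1 ** (tnth (in_tuple v) i).1)) (tau_cp _ _)
      (fun i => (tnth (in_tuple v) i).2)).
have [K [iota [iotaP iota_dense]]] := hilbert_completion [::] sP.
pose g a h := iota [:: (a, h)].
have g_gram a b : gram (tau (star a ** b)) (g a) (g b).
  by move=> h k; rewrite iotaP /s !big_seq1.
have iota_lin := iota_comb_linear sP iotaP.
have iotaE v : iota v = formal_sum g v.
  elim: v => [|[a h] v IHv].
    by rewrite /formal_sum big_nil; apply: hdot_eq0; rewrite iotaP /s big_nil.
  rewrite /formal_sum big_cons -/(formal_sum g v) -IHv.
  have := iota_lin 1 [:: (a, h)] v.
  by rewrite /formal_comb /= !scale1r.
exists K, g; split=> // [a|u d d0]; last first.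
  by have [v vP] := iota_dense u d d0; exists v; rewrite -iotaE.
apply/bounded_operatorP; split=> [k x y|]; last first.
  exists (Num.sqrt (nrm (tau (star a ** a)))); first exact: sqrtr_ge0.
  by move=> h; exact: gram_bound.
apply: (dense_injl iota_dense) => v.
rewrite iotaE hdotDl hdotZl !(hdot_sumr _ (g a _)) mulr_sumr -big_split.
apply: eq_bigr => -[b h] _ /=.
by rewrite !g_gram hdotDl hdotZl.
Qed.

Variables (K : hilbertType R) (g : A -> H -> K).
Hypothesis gP : dilation g.

Lemma dil_linear a : linear (g a).
Proof. by have [] := dil_bounded gP a. Qed.

Lemma dil_injl x y : (forall a h, hdot x (g a h) = hdot y (g a h)) -> x = y.
Proof.
move=> xy; apply: (dense_injl (dil_dense gP)) => v.
by rewrite /formal_sum !hdot_sumr; apply: eq_bigr.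
Qed.

Lemma dil_injr x y : (forall a h, hdot (g a h) x = hdot (g a h) y) -> x = y.
Proof. by move=> xy; apply: dil_injl => a h; rewrite hdotC xy -hdotC. Qed.

Lemma dil_total z : (forall a h, hdot z (g a h) = 0) -> z = 0.
Proof. by move=> z0; apply: dil_injl => a h; rewrite z0 hdot0l. Qed.

Lemma dil_lin k a b h : g (k *: a + b) h = k *: g a h + g b h.
Proof.
apply: dil_injr => c x; rewrite hdotDr hdotZr !(dil_gram gP).
by rewrite cmulDr cmulZr linearP vn_opD vn_opZ hdotDr hdotZr.
Qed.

Lemma dil_operator_eq (L : hilbertType R) (f1 f2 : K -> L) :
  bounded_operator f1 -> bounded_operator f2 ->
  (forall a h, f1 (g a h) = f2 (g a h)) -> f1 =1 f2.
Proof.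
move=> b1 b2 f12; apply: (dense_eq_operator (dil_dense gP) b1 b2) => v.
have [l1 _] := b1; have [l2 _] := b2.
by rewrite /formal_sum (lin_sum l1) (lin_sum l2); apply: eq_bigr.
Qed.

(** The quadratic form <v, c v> of left multiplication by [c] on K, written through [tau] since that
    operator is still to be constructed. *)
Let form (c : A) (v : seq (A * H)) : R[i] := \sum_(p <- v) \sum_(q <- v)
  hdot p.2 (vn_op (tau (star p.1 ** c ** q.1)) q.2).

Let form_lin k c d v : form (k *: c + d) v = k * form c v + form d v.
Proof.
rewrite /form mulr_sumr -big_split; apply: eq_bigr => p _ /=.
rewrite mulr_sumr -big_split; apply: eq_bigr => q _ /=.
by rewrite cmulDr cmulZr cmulDl cmulZl linearP vn_opD vn_opZ hdotDr hdotZr.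
Qed.

(** The vectors w a h behave like c^(1/2) a (x) h. Left multiplication by d, with c = d^* d, and the
    family t'_(T(xa)), with c = <x, x>, are both of this kind. *)
Definition weighted_family (L : hilbertType R) (c : A) (w : A -> H -> L) : Prop :=
  forall a b, gram (tau (star a ** c ** b)) (w a) (w b).

Let form_weighted (L : hilbertType R) c (w : A -> H -> L) v :
  weighted_family c w -> form c v = hdot (formal_sum w v) (formal_sum w v).
Proof.
move=> wP; rewrite /formal_sum hdot_suml; apply: eq_bigr => p _.
by rewrite hdot_sumr; apply: eq_bigr => q _; rewrite wP.
Qed.

Lemma weighted_left_mul a : weighted_family (star a ** a) (fun b => g (a ** b)).
Proof.
move=> b c h k; rewrite (dil_gram gP) starM; congr (hdot _ (vn_op (tau _) _)).
by rewrite !cmulA.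
Qed.

(** As 1 - a^* a / M^2 is a square y^* y, its form is a squared norm. The choice M = |a| + 1 keeps M
    invertible. *)
Let form_square_le a : exists2 M : R, 0 <= M &
  forall v, complex.Re (form (star a ** a) v) <= M ^+ 2 * complex.Re (form cone v).
Proof.
pose M := nrm a + 1; have M0 : 0 < M by rewrite ltr_wpDl ?nrm_ge0.
exists M; first exact: ltW.
pose k : R[i] := (M ^- 2)%:C%C; pose x := k *: (star a ** a).
have x_sa : star x = x by rewrite starZ conj_real starM starK.
have x1 : nrm x <= 1.
  rewrite nrmZ nrm_star_cmul nrm_real ger0_norm ?invr_ge0 ?sqr_ge0//.
  rewrite mulrC ler_pdivrMr ?exprn_gt0// mul1r ler_sqr ?nnegrE ?nrm_ge0 ?(ltW M0)//.
  by rewrite lerDl.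
have [y y_sa yy] := one_minus_sqrt x_sa x1.
move=> v; have : 0 <= form (star y ** y) v.
  by rewrite (form_weighted _ (weighted_left_mul y)) hdot_norm exprn_ge0.
rewrite y_sa yy /x -scaleNr addrC form_lin => /ge0_Re.
rewrite ReD mulNr ReN Re_realM addrC subr_ge0 mulrC ler_pdivrMr ?exprn_gt0//.
by rewrite mulrC.
Qed.

Lemma weighted_extension (L : hilbertType R) a (w : A -> H -> L) :
  (forall b, linear (w b)) -> weighted_family (star a ** a) w ->
  exists2 f : K -> L, bounded_operator f & forall b h, f (g b h) = w b h.
Proof.
move=> w_lin wP; have [M M0 MP] := form_square_le a.
have g1 : weighted_family cone g by move=> b c h k; rewrite (dil_gram gP) cmulr1.
have [v|f fb fP] := @operator_extension R _ K (formal_sum g) (dil_dense gP)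
    (@formal_comb R A H) [::] L (formal_sum w) M
    (formal_sum_linear dil_linear) (formal_sum_linear w_lin) M0.
  rewrite -ler_sqr ?nnegrE ?mulr_ge0 ?nrm_ge0// exprMn -!Re_hdotxx.
  by rewrite -(form_weighted v wP) -(form_weighted v g1).
exists f => // b h.
by have := fP [:: (b, h)]; rewrite /formal_sum !big_seq1.
Qed.

End Dilation.

(** * Self-duality and the Stinespring module *)

Section StrongClosure.
Variables (R : realType) (H : hilbertType R) (B : vnAlgType H).

(** Composition with f^* is strongly continuous, and B is strongly closed. *)
Lemma has_gram_closed (K : hilbertType R) (f f' : H -> K) :
  bounded_operator f -> bounded_operator f' ->
  strong_approx [set f1 | has_gram B f f1]%classic f' -> has_gram B f f'.
Proof.
move=> fb f'b f'_approx; have [s sb sP] := hilbert_adjoint fb.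
have /bounded_operatorP[s_lin [M M0 sM]] := sb.
have [r e e0|c _ cP] := (strongly_closedP _).1 (@vn_op_closed _ _ B) _
    (bounded_operator_comp f'b sb).
  have [f1 [c cP] f1P] := f'_approx r (e / (M + 1)) (divr_gt0 e0 (ltr_wpDl M0 ltr01)).
  exists (vn_op c); first by exists c.
  move=> x /f1P xP; have <- : s (f1 x) = vn_op c x.
    by apply: hdot_injr => z; rewrite -sP cP.
  rewrite -(linB s_lin); apply: le_trans (sM _) _.
  apply: le_trans (ler_wpM2l M0 xP) _.
  rewrite mulrCA ler_piMr ?(ltW e0)// ler_pdivrMr ?ltr_wpDl// mul1r.
  by rewrite lerDl.
by exists c => h k; rewrite sP cP.
Qed.

Section InteriorTensor.
Variables (E : preHilbertModType B) (K : hilbertType R) (t : E -> H -> K).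
Hypothesis tP : interior_tensor t.

Lemma itens_gram x y : gram (inner x y) (t x) (t y).
Proof. exact: itens_dot tP x y. Qed.

Lemma itens_sqrt_inner (x : E) : Num.sqrt (nrm (inner x x)) = nrm x.
Proof.
have -> : nrm (inner x x) = nrm x ^+ 2.
  by apply: complexI; rewrite -nrmE inner_norm nrmE rmorphXn.
by rewrite sqrtr_sqr ger0_norm// nrm_ge0.
Qed.

Lemma itens_bound (x : E) h : nrm (t x h) <= nrm x * nrm h.
Proof. by rewrite -(itens_sqrt_inner x); exact: gram_bound (itens_gram x x). Qed.

Lemma itens_lub (x : E) (M : R) : 0 <= M -> (forall h, nrm (t x h) <= M * nrm h) ->
  nrm x <= M.
Proof. by rewrite -(itens_sqrt_inner x); exact: gram_lub (itens_gram x x). Qed.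

Lemma itens_bounded x : bounded_operator (t x).
Proof.
apply/bounded_operatorP; split=> [k h h'|].
  by rewrite (itensDr tP) (itensZr tP).
exists (nrm x); [exact: nrm_ge0|exact: itens_bound].
Qed.

Lemma itens_linearl h : linear (fun x => t x h).
Proof. by move=> k x y; rewrite (itensDl tP) (itensZl tP). Qed.

Lemma itens_inj x y : (forall h, t x h = t y h) -> x = y.
Proof.
move=> xy; apply/eqP; rewrite -subr_eq0; apply/eqP/nrm_eq0/eqP.
rewrite eq_le nrm_ge0 andbT; apply: itens_lub => // h.
by rewrite (linB (itens_linearl h)) xy subrr nrm0 mul0r.
Qed.

Lemma itens_total z : (forall x h, hdot z (t x h) = 0) -> z = 0.
Proof.
move=> z0; have /denseP tdense := itens_dense tP.
apply: (@dense_orth R (seq (E * H)) K (formal_sum t)).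
  move=> u d /(tdense u)[_ [n [x [h ->]]] uP].
  exists [seq (x i, h i) | i <- index_enum 'I_n].
  by rewrite /formal_sum big_map.
by move=> v; rewrite /formal_sum hdot_sumr big1.
Qed.

(** By [strong_density], [f] is a strong limit of operators h |-> sum t_x (b h), and these come from
    the elements sum x b of E. *)
Lemma von_neumann_self_dual (f : H -> K) : strongly_closed (range t) ->
  bounded_operator f -> (forall x, has_gram B (t x) f) ->
  exists y, forall h, t y h = f h.
Proof.
move=> /strongly_closedP t_closed fb ft.
have [r e e0|y _ <-] := t_closed f fb; last by exists y.
have [||||v vP] := @strong_density R H B K E t f _ _ _ _ r e e0.
- exact: itens_bounded.
- by move=> x y; exists (inner x y); exact: itens_gram.
- exact: itens_total.
- exact: ft.
exists (t (\sum_(p <- v) ract p.1 p.2)); first by exists (\sum_(p <- v) ract p.1 p.2).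
move=> h /vP; rewrite (lin_sum (itens_linearl h)).
congr (nrm (_ - _) <= e); apply: eq_bigr => p _.
by rewrite (itens_balanced tP).
Qed.

End InteriorTensor.

Section StinespringModule.
Variables (A : cstarAlgType R) (tau : {linear A -> B}).
Variables (K : hilbertType R) (g : A -> H -> K).
Hypothesis gP : dilation tau g.

(* The self-dual module generated by the operators g a. *)
Definition dilation_ops : set (H -> K) :=
  [set f | bounded_operator f /\ forall a, has_gram B (g a) f]%classic.

Lemma dilation_ops_gen a : dilation_ops (g a).
Proof.
split=> [|b]; first exact: dil_bounded gP a.
by exists (tau (star b ** a)); exact: dil_gram gP b a.
Qed.

Lemma dilation_ops_module : operator_module B dilation_ops.
Proof.
split=> [f [[]]//||k f f' [fb fg] [fb' fg']|f b [fb fg]|f f' [fb fg] [fb' fg']].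
- split=> [|a]; last by exists 0; exact: gram0.
  apply/bounded_operatorP; split=> [k x y|]; first by rewrite scaler0 addr0.
  by exists 0 => // x; rewrite nrm0 mul0r.
- split=> [|a]; last first.
    have [c cP] := fg a; have [c' cP'] := fg' a.
    by exists (k *: c + c'); exact: gram_lin.
  have /bounded_operatorP[fl [M M0 fM]] := fb.
  have /bounded_operatorP[fl' [M' M0' fM']] := fb'.
  apply/bounded_operatorP; split=> [l x y|].
    by rewrite fl fl' !scalerDr !scalerA [l * k]mulrC addrACA.
  exists (nrm k * M + M'); first by rewrite addr_ge0 ?mulr_ge0 ?nrm_ge0.
  move=> x; rewrite mulrDl; apply: le_trans (nrmD _ _) _.
  by rewrite nrmZ -mulrA lerD// ler_wpM2l ?nrm_ge0.
- split=> [|a]; first exact: bounded_operator_comp (vn_op_bounded b) fb.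
  by have [c cP] := fg a; exists (c ** b); exact: gram_ract.
(* Here f' is a strong limit of sums of operators g_a b, and f^* g_a is in B because g_a^* f is. *)
- apply: has_gram_closed => // r e e0.
  have [||||v vP] := @strong_density R H B K A g f' _ _ _ _ r e e0.
  + exact: dil_bounded gP.
  + by move=> a b; exists (tau (star a ** b)); exact: dil_gram gP a b.
  + exact: dil_total gP.
  + exact: fg'.
  exists (fun x => formal_sum (fun a b => g a (vn_op b x)) v) => //.
  apply: gram_sum => a; have [c cP] := fg a.
  by exists (star c); exact: gram_sym.
Qed.

Lemma dilation_ops_closed : strongly_closed dilation_ops.
Proof.
apply/strongly_closedP => f fb f_approx; split=> // a.
apply: has_gram_closed => //; first exact: dil_bounded gP a.
by move=> r e /(f_approx r)[f1 [_ f1g] f1P]; exists f1 => //; exact: f1g.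
Qed.

Lemma dilation_module : exists (F : preHilbertModType B) (t : F -> H -> K),
  interior_tensor t /\ range t = dilation_ops.
Proof.
apply: (von_neumann_operator_module dilation_ops_module) => u d d0.
have [v vP] := dil_dense gP u d0.
exists (size v), (fun i => g (tnth (in_tuple v) i).1), (fun i => (tnth (in_tuple v) i).2).
by split=> [i|]; [exact: dilation_ops_gen|by move: vP; rewrite /formal_sum big_tnth].
Qed.

End StinespringModule.
End StrongClosure.

(** * The operators behind pi and Psi, and the theorem *)

Section Conclusion.
Variables (R : realType) (A : cstarAlgType R) (H : hilbertType R) (B : vnAlgType H).
Variables (E : hilbertModType A) (E' : preHilbertModType B).
Variables (tau : {linear A -> B}) (T : E -> E').
Hypothesis tau_T : tau_map tau T.

Variables (K : hilbertType R) (g : A -> H -> K).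
Hypothesis gP : dilation tau g.

Lemma left_multiplication a : exists2 p : K -> K, bounded_operator p &
  forall b h, p (g b h) = g (a ** b) h.
Proof.
apply: (weighted_extension gP) => [b|]; first exact: (dil_linear gP).
exact: weighted_left_mul.
Qed.

Lemma left_multiplication_adjoint a (p q : K -> K) :
  bounded_operator p -> (forall b h, p (g b h) = g (a ** b) h) ->
  bounded_operator q -> (forall b h, q (g b h) = g (star a ** b) h) ->
  forall u w, hdot (p u) w = hdot u (q w).
Proof.
move=> pb pE qb qE u w; have [s sb sP] := hilbert_adjoint pb.
rewrite sP; congr hdot; apply: (dil_operator_eq gP sb qb) => b h.
apply: (dil_injr gP) => c k; rewrite -sP pE qE !(dil_gram gP) starM.
by rewrite cmulA.
Qed.

Lemma inner_racts (x y : E) a b :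
  inner (ract x a) (ract y b) = star a ** inner x y ** b.
Proof. by rewrite inner_ract innerC inner_ract starM -innerC. Qed.

Variables (K' : hilbertType R) (t' : E' -> H -> K').
Hypothesis t'P : interior_tensor t'.

(** Since <x a, x b> = a^* <x, x> b, the family t'_(T(xa)) is weighted by <x, x>, and positivity in
    the Hilbert module E factors this weight as d^* d. *)
Lemma module_operator (x : E) : exists2 p : K -> K', bounded_operator p &
  forall a h, p (g a h) = t' (T (ract x a)) h.
Proof.
have [d dP] := inner_ge0 x.
apply: (weighted_extension gP (a := d)) => [a k h h'|a b].
  by rewrite (itensDr t'P) (itensZr t'P).
by rewrite -dP -inner_racts -tau_T; exact: itens_gram.
Qed.

End Conclusion.

Theorem theorem2p2 (R : realType) (A : cstarAlgType R)
    (H : hilbertType R) (B : vnAlgType H)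
    (E : hilbertModType A) (E' : preHilbertModType B)
    (tau : {linear A -> B}) (T : E -> E') :
  von_neumann_module E' ->
  completely_positive tau ->
  tau_map tau T ->
  exists (F : preHilbertModType B) (pi : A -> adjointable F F)
         (V : adjointable (regmod B) F),
    [/\ von_neumann_module F,
        representation pi,
        (forall (a : A) (b : B), tau a ** b = adjoint V (pi a (V b))) &
        exists (F' : preHilbertModType B) (Psi : E -> adjointable F F')
               (S : adjointable E' F'),
          [/\ von_neumann_module F',
              quasi_representation Psi,
              associated pi Psi,
              coisometry S &
              (forall (x : E) (b : B),
                 ract (T x) b = adjoint S (Psi x (V b)))]].
Proof.
move=> E'_vn tau_cp tau_T.
have [K [g gP]] := dilation_exists tau_cp.
have [F [t [tP t_range]]] := dilation_module gP.
have [K' [t' [t'P t'_closed]]] := E'_vn.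
have F_vn : von_neumann_module F.
  by exists K, t; split=> //; rewrite t_range; exact: dilation_ops_closed gP.
have tF f : dilation_ops B g (t f) by rewrite -t_range; exists f.
have Ft (f : H -> K) : dilation_ops B g f -> exists y, forall h, t y h = f h.
  by rewrite -t_range => -[y _ <-]; exists y.
have /choice[p0 p0P] a : exists p : K -> K, bounded_operator p /\
    forall b h, p (g b h) = g (a ** b) h.
  by have [p pb pE] := left_multiplication gP a; exists p.
have p0b a : bounded_operator (p0 a) by case: (p0P a).
have p0E a b h : p0 a (g b h) = g (a ** b) h by case: (p0P a) => _ ->.
have p0_adj a u w : hdot (p0 a u) w = hdot u (p0 (star a) w).
  exact: (left_multiplication_adjoint gP (p0b a) (p0E a) (p0b _) (p0E _)).
have p0_lin k a b u : p0 (k *: a + b) u = k *: p0 a u + p0 b u.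
  apply: (dil_injl gP) => c x; rewrite hdotDl hdotZl !p0_adj !p0E starD starZ.
  by rewrite cmulDl cmulZl (dil_lin gP) hdotDr hdotZr.
have p0M a b u : p0 (a ** b) u = p0 a (p0 b u).
  by apply: (dil_injl gP) => c x; rewrite !p0_adj !p0E starM cmulA.
have /choice[pif pifP] a : exists pa : F -> F, forall f h, t (pa f) h = p0 a (t f h).
  suff /choice[pa paP] f : exists y, forall h, t y h = p0 a (t f h) by exists pa.
  apply: Ft; split; first exact: bounded_operator_comp (itens_bounded tP f) (p0b a).
  (* Left multiplication preserves F because g_b^* p_a is the adjoint of g at a^* b. *)
  move=> b; have [_ /(_ (star a ** b))[c cP]] := tF f.
  by exists c => h k; rewrite -cP -p0E p0_adj starK.
have pif_adj a : is_adjoint (pif a) (pif (star a)).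
  move=> x y; apply: vn_op_hdot_inj => h k.
  by rewrite -!(itens_dot tP) !pifP p0_adj.
pose pi a : adjointable F F := Adjointable (ex_intro _ _ (pif_adj a)).
have pi_rep : representation pi.
  split=> [a b f|k a f|a b f|a f].
  - apply: (itens_inj tP) => h; rewrite (itensDl tP) !pifP.
    by have := p0_lin 1 a b (t f h); rewrite !scale1r.
  - apply: (itens_inj tP) => h; rewrite (itensZl tP) !pifP.
    have p00 : p0 0 (t f h) = 0.
      have /eqP := p0_lin 1 0 0 (t f h); rewrite !scale1r addr0 eq_sym.
      by rewrite -subr_eq0 addrK => /eqP.
    by have := p0_lin k a 0 (t f h); rewrite p00 !addr0.
  - by apply: (itens_inj tP) => h; rewrite !pifP p0M.
  - by rewrite (adjoint_unique (adjointP (pi a)) (pif_adj a)).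
(* The element [v] represents h |-> 1 (x) h, and the adjoint of b |-> v b is the inner product with
   [v]. *)
have [v vP] := Ft _ (dilation_ops_gen gP cone).
pose V0 (b : regmod B) : F := ract v b; pose V1 (f : F) : regmod B := inner v f.
have V_adj : is_adjoint V0 V1.
  by move=> b f; rewrite /V0 innerC inner_ract starM -innerC.
pose V : adjointable (regmod B) F := Adjointable (ex_intro _ _ V_adj).
have /choice[q0 q0P] x : exists q : K -> K', bounded_operator q /\
    forall a h, q (g a h) = t' (T (ract x a)) h.
  by have [q qb qE] := module_operator tau_T gP t'P x; exists q.
have q0b x : bounded_operator (q0 x) by case: (q0P x).
have q0E x a h : q0 x (g a h) = t' (T (ract x a)) h by case: (q0P x) => _ ->.
have /choice[s0 s0P] x : exists s : K' -> K, bounded_operator s /\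
    forall u w, hdot (q0 x u) w = hdot u (s w).
  by have [s sb sP] := hilbert_adjoint (q0b x); exists s.
have s0b x : bounded_operator (s0 x) by case: (s0P x).
have s0_adj x u w : hdot (q0 x u) w = hdot u (s0 x w) by case: (s0P x) => _ ->.
(* The adjoint of q_x maps E' into F, as g_a^* q_x^* t'_y = <T(xa), y>. *)
have s0F x y : dilation_ops B g (fun h => s0 x (t' y h)).
  split=> [|a]; first exact: bounded_operator_comp (itens_bounded t'P y) (s0b x).
  exists (inner (T (ract x a)) y) => h k.
  by rewrite -s0_adj q0E (itens_dot t'P).
have /choice[Psif PsifP] x : exists f : F -> E',
    forall y h, t' (f y) h = q0 x (t y h).
  suff /choice[f fP] y : exists z, forall h, t' z h = q0 x (t y h) by exists f.
  apply: (von_neumann_self_dual t'P t'_closed).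
    exact: bounded_operator_comp (itens_bounded tP y) (q0b x).
  move=> z; have [c cP] := om_gram (dilation_ops_module gP) (s0F x z) (tF y).
  by exists c => h k; rewrite -cP hdotC s0_adj -hdotC.
have Psi_adj x : exists f : E' -> F, is_adjoint (Psif x) f.
  have /choice[f fP] y : exists z, forall h, t z h = s0 x (t' y h) by exact: Ft (s0F x y).
  exists f => y z; apply: vn_op_hdot_inj => h k.
  by rewrite -(itens_dot t'P) -(itens_dot tP) PsifP fP s0_adj.
pose Psi x : adjointable F E' := Adjointable (Psi_adj x).
have Psi_assoc : associated pi Psi.
  move=> x y f1 f2.
  (* The identity q_x^* q_y = pi(<x, y>) at the level of K: on generators both sides reduce to
     tau(b^* <x, y> a), by the hypothesis on [T]. *)
  have sq : (fun u => s0 x (q0 y u)) =1 p0 (inner x y).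
    apply: (dil_operator_eq gP) => [||a h].
    - exact: bounded_operator_comp (q0b y) (s0b x).
    - exact: p0b.
    - apply: (dil_injr gP) => b k; rewrite -s0_adj !q0E (itens_dot t'P) p0E.
      by rewrite (dil_gram gP) tau_T inner_racts cmulA.
  apply: vn_op_hdot_inj => h k.
  rewrite -(itens_dot t'P) -(itens_dot tP) !PsifP pifP -sq.
  by rewrite hdotC s0_adj -hdotC.
have id_adj : is_adjoint (id : E' -> E') id by [].
pose S : adjointable E' E' := Adjointable (ex_intro _ _ id_adj).
have SE : adjoint S = id := adjoint_unique (adjointP S) id_adj.
exists F, pi, V; split=> // [a b|].
  rewrite (adjoint_unique (adjointP V) V_adj); apply: vn_op_hdot_inj => h k.
  rewrite -(itens_dot tP) pifP (itens_balanced tP) !vP p0E cmulr1.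
  by rewrite (dil_gram gP) star_cone cmul1 vn_opM.
exists E', Psi, S; split=> //.
- split; last by exists pi.
  move=> x; split; last first.
    move=> f b; apply: (itens_inj t'P) => h.
    by rewrite (itens_balanced t'P) !PsifP (itens_balanced tP).
  have /bounded_operatorP[q_lin [M M0 qM]] := q0b x.
  apply/bounded_operatorP; split=> [k y z|].
    apply: (itens_inj t'P) => h; rewrite (itensDl t'P) (itensZl t'P) !PsifP.
    by rewrite (itensDl tP) (itensZl tP) q_lin.
  exists M => // f; apply: (itens_lub t'P) => [|h].
    by rewrite mulr_ge0 ?nrm_ge0.
  rewrite PsifP; apply: le_trans (qM _) _; rewrite -mulrA ler_wpM2l//.
  exact: itens_bound.
- by move=> y; rewrite SE.
- move=> x b; rewrite SE; apply: (itens_inj t'P) => h.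
  (* As V takes its values through g_1, q_x is evaluated at a = 1, where x a = x. *)
  by rewrite PsifP (itens_balanced tP) vP q0E (itens_balanced t'P) ract1.
Qed.
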